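(* Let $G \cong C_2 \oplus C_2 \oplus C_{2n}$, where $n \ge 2$ is an integer. A sequence $S$ over $G$ of length $|S| = \mathsf{s}(G) - 1 = 4n+2$ contains no zero-sum subsequence of length $\exp(G)=2n$ if and only if there exist a basis $\{f_1,f_2,f_3\}$ of $G$ with $\operatorname{ord}(f_1)=\operatorname{ord}(f_2)=2$ and $\operatorname{ord}(f_3)=2n$, and an element $f \in G$, such that the translated sequence $-f + S$ is equal to one of the following sequences: (s1) $0^{2\alpha+1} f_2^{2n-2\alpha-1} f_3^{2n-1-2\beta} (f_3+f_2)^{2\beta+1} (a f_3 + f_1)\bigl((1-a) f_3 + f_2 + f_1\bigr)$ with $a \in [2,n-1]$ and $\alpha,\beta \in [0,n-1]$; (s2) $0^{2n-1} f_3^{2n-1} (a f_3 + f_2)\bigl((1-a)f_3 + f_2\bigr)(b f_3 + f_1)\bigl((1-b) f_3 + f_1\bigr)$ with $a,b \in [2,n-1]$ and $a \ge b$; (s3) $0^{2\alpha+1} f_1^{2\beta+1} f_2^{2\gamma+1} \prod_{i=1}^{2n+1} (f_3 + d_i)$, where $\alpha,\beta,\gamma \in [0,n-1]$ satisfy $\alpha+\beta+\gamma = n-1$, and $S' = \prod_{i=1}^{2n+1} d_i$ is a sequence over the subgroup $\langle f_1,f_2\rangle$ with $\sigma(S') \notin \operatorname{supp}(S')$.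
   Context: $C_m$ denotes a cyclic group of order $m$; $\operatorname{ord}(g)$ is the order of $g$; $[a,b]=\{z\in\mathbb{Z}: a\le z\le b\}$. A basis of a finite abelian group is an independent generating set, where $g_1,\dots,g_k$ are independent if $\sum a_i g_i = 0$ with integers $a_i$ implies $a_i g_i = 0$ for all $i$. A sequence over $G$ is an element of the free abelian monoid over $G$ (finite multiset, written multiplicatively; $g^k$ means $g$ repeated $k$ times). For $S = g_1\cdots g_\ell$: $|S|=\ell$, $\sigma(S)=\sum g_i$, $\operatorname{supp}(S)$ is the set of distinct elements occurring in $S$; for $h\in G$, $h+S = (h+g_1)\cdots(h+g_\ell)$. A subsequence is a sub-multiset; a zero-sum sequence is one with sum $0$. $\exp(G)$ is the exponent of $G$. $\mathsf{s}(G)$ (Erdős–Ginzburg–Ziv constant) is the smallest integer $\ell$ such that every sequence over $G$ of length at least $\ell$ has a zero-sum subsequence of length exactly $\exp(G)$; for this $G$, $\mathsf{s}(G)=4n+3$. *)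

(* Defs.v *)
(* Written with the Mathematical Components library. *)
From HB Require Import structures.
From mathcomp Require Import all_boot all_order all_algebra all_fingroup.

Set Implicit Arguments.
Unset Strict Implicit.
Unset Printing Implicit Defensive.

Import GRing.Theory.
Local Open Scope ring_scope.

(* Finite abelian groups are additive ([finZmodType]). MathComp views such a
   type also as a multiplicatively written [finGroupType] with the same
   operation; this gives access to the order [#[g]%g] and the generated
   subgroup [<<A>>%g]. *)

(* A sequence over G, i.e. an element of the free abelian monoid over G, is a
   [seq G] considered up to [perm_eq]. Sums and lengths do not depend on the
   order of the terms, and by [count_subseqP] the sub-multisets of [S] are,
   up to [perm_eq], exactly the [subseq]s of [S]. *)
Definition has_zero_sum_subseq (G : finZmodType) (k : nat) (S : seq G) : Prop :=
  exists T : seq G, [/\ subseq T S, size T = k & \sum_(g <- T) g = 0].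

Definition translate (G : finZmodType) (h : G) (S : seq G) : seq G :=
  [seq h + g | g <- S].

Definition independent (G : finZmodType) (gs : seq G) : Prop :=
  forall a : 'I_(size gs) -> int,
    \sum_(i < size gs) gs`_i *~ a i = 0 ->
    forall i : 'I_(size gs), gs`_i *~ a i = 0.

Definition group_basis (G : finZmodType) (gs : seq G) : Prop :=
  independent gs /\ <<[set g in gs]>>%g = [set: G].

(* All natural-number subtractions below are exact in the parameter ranges in
   which the sequences are used (alpha, beta <= n - 1). *)
Definition seq_s1 (G : finZmodType) (n : nat) (f1 f2 f3 : G)
    (a alpha beta : nat) : seq G :=
  nseq (2 * alpha + 1) 0 ++ nseq (2 * n - 2 * alpha - 1) f2
  ++ nseq (2 * n - 1 - 2 * beta) f3 ++ nseq (2 * beta + 1) (f3 + f2)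
  ++ [:: f3 *~ a%:Z + f1; f3 *~ (1 - a%:Z) + f2 + f1].

Definition seq_s2 (G : finZmodType) (n : nat) (f1 f2 f3 : G)
    (a b : nat) : seq G :=
  nseq (2 * n - 1) 0 ++ nseq (2 * n - 1) f3
  ++ [:: f3 *~ a%:Z + f2; f3 *~ (1 - a%:Z) + f2;
         f3 *~ b%:Z + f1; f3 *~ (1 - b%:Z) + f1].

Definition seq_s3 (G : finZmodType) (f1 f2 f3 : G)
    (alpha beta gamma : nat) (d : seq G) : seq G :=
  nseq (2 * alpha + 1) 0 ++ nseq (2 * beta + 1) f1 ++ nseq (2 * gamma + 1) f2
  ++ [seq f3 + x | x <- d].

(* Main.v *)
(** Pair off terms of [S] that agree modulo [2G], a cyclic group of order [n]. As
[G / 2G] has 8 elements, there are [2n - 3] disjoint pairs and 8 remaining terms.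
Every sequence of [2n - 2] terms in an abelian group of order [n] without
zero-sum subsequence of length [n] has the form [a^(n-1) b^(n-1)], with [b - a] of
order [n] (inverse Erdos-Ginzburg-Ziv theorem, proved here via Scherk's theorem).
So there is at most one [w] that the sequence of the [2n - 3] pair sums can be
extended by without creating a zero-sum subsequence of length [n]. Every further
pair [y, z] must therefore satisfy [y + z = w], and every quadruple [Q] among the
remaining terms with sum in [2G], weighing as much as two pairs, must satisfy
[sigma(Q) = - w - (sum of all pair sums)]. The affine planes of [G / 2G] turn this
rigidity into a contradiction when the remaining 8 terms are distinct modulo
[2G]. Otherwise all pairs consist of equal terms, [S] has support
[u1, u2, u3, s - u1, s - u2, s - u3] with odd multiplicities and [2s = a + b], and
a multiplicity exceeds 1 only if [2 u_i] is [a] or [b]. The forms (s3), (s1), (s2)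
correspond to 3, 2, 1 indices [i] with [2 u_i] equal to [a] or [b]. *)
Require Import Defs.
From HB Require Import structures.
From mathcomp Require Import all_boot all_order all_algebra all_fingroup.
From mathcomp Require Import cyclic zify.
Set Implicit Arguments.
Unset Strict Implicit.
Unset Printing Implicit Defensive.
Import GRing.Theory.
Local Open Scope ring_scope.

(** * Linear identities in abelian groups *)

Inductive zexp := ZVar of nat | ZZero | ZAdd of zexp & zexp | ZOpp of zexp
  | ZMul of zexp & nat.

Fixpoint zeval (G : zmodType) (env : seq G) (e : zexp) : G :=
  match e with
  | ZVar i => nth 0 env i
  | ZZero => 0
  | ZAdd a b => zeval env a + zeval env b
  | ZOpp a => - zeval env a
  | ZMul a k => zeval env a *+ k
  end.

Fixpoint zcoef (e : zexp) (i : nat) : int :=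
  match e with
  | ZVar j => (i == j)%:Z
  | ZZero => 0
  | ZAdd a b => zcoef a i + zcoef b i
  | ZOpp a => - zcoef a i
  | ZMul a k => zcoef a i *+ k
  end.

Lemma zevalE (G : zmodType) (env : seq G) e :
  zeval env e = \sum_(i < size env) env`_i *~ zcoef e i.
Proof.
elim: e => [j||a IHa b IHb|a IHa|a IHa k] /=; rewrite ?IHa ?IHb.
- have [hj|hj] := ltnP j (size env).
    rewrite (bigD1 (Ordinal hj)) //= eqxx mulr1z big1 ?addr0 // => i.
    by rewrite -val_eqE /= => /negbTE ->; rewrite mulr0z.
  rewrite nth_default // big1 // => i _; case: eqP => [e|]; rewrite ?mulr0z //.
  by have := ltn_ord i; rewrite e ltnNge hj.
- by rewrite big1 // => i _; rewrite mulr0z.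
- by rewrite -big_split; apply: eq_bigr => i _; rewrite mulrzDr.
- by rewrite -sumrN; apply: eq_bigr => i _; rewrite mulrNz.
- by rewrite -sumrMnl; apply: eq_bigr => i _; rewrite pmulrn -mulrzA -natz mulr_natr.
Qed.

Lemma zeval_eq (G : zmodType) (env : seq G) e e' :
  all (fun i => zcoef e i == zcoef e' i) (iota 0 (size env)) ->
  zeval env e = zeval env e'.
Proof.
move=> /allP h; rewrite !zevalE; apply: eq_bigr => i _.
by rewrite (eqP (h i _)) // mem_iota /= ltn_ord.
Qed.

Lemma zeval_eq2 (G : zmodType) (env : seq G) e e' : (forall x : G, x + x = 0) ->
  all (fun i => ~~ odd `|zcoef e i - zcoef e' i|%N) (iota 0 (size env)) ->
  zeval env e = zeval env e'.
Proof.
move=> h2 /allP h; apply/eqP; rewrite -subr_eq0 !zevalE -sumrB; apply/eqP.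
apply: big1 => i _; rewrite -mulrzBr.
have := h i; rewrite mem_iota ltn_ord => /(_ isT); move: (_ - _) => z hz.
suff hk k : env`_i *+ k.*2 = 0.
  case: z hz => m; rewrite /= -?pmulrn ?NegzE ?mulrNz => hz.
    by rewrite -(even_halfK hz) hk.
  by rewrite -pmulrn -(@even_halfK m.+1 hz) hk oppr0.
by rewrite -muln2 mulnC mulrnA mulr2n h2 mul0rn.
Qed.

(* Atoms are compared up to conversion, as the same term may be displayed through
   different paths of the algebraic hierarchy. *)
Ltac zidx x l :=
  match l with
  | ?y :: _ => let u := match goal with _ => unify x y end in constr:(0%N)
  | _ :: ?l' => let k := zidx x l' in constr:(S k)
  end.

Ltac zin x l :=
  match l with
  | ?y :: _ => let u := match goal with _ => unify x y end in constr:(true)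
  | _ :: ?l' => zin x l'
  | _ => constr:(false)
  end.

Ltac closed_nat k :=
  lazymatch k with
  | O => constr:(true)
  | S ?k' => closed_nat k'
  | _ => constr:(false)
  end.

Ltac zatom x l :=
  lazymatch zin x l with true => l | false => constr:(x :: l) end.

Ltac zvars e l :=
  lazymatch e with
  | ?a + ?b => let l' := zvars a l in zvars b l'
  | - ?a => zvars a l
  | ?a *+ ?k => lazymatch closed_nat k with true => zvars a l | false => zatom e l end
  | 0 => l
  | ?x => zatom x l
  end.

Ltac zreify e l :=
  lazymatch e with
  | ?a + ?b => let a' := zreify a l in let b' := zreify b l in constr:(ZAdd a' b')
  | - ?a => let a' := zreify a l in constr:(ZOpp a')
  | ?a *+ ?k =>
    lazymatch closed_nat k with
    | true => let a' := zreify a l in constr:(ZMul a' k)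
    | false => let k := zidx e l in constr:(ZVar k)
    end
  | 0 => constr:(ZZero)
  | ?x => let k := zidx x l in constr:(ZVar k)
  end.

Ltac zmod_with tac :=
  lazymatch goal with |- @eq ?T ?a ?b =>
    let l := zvars a (@nil T) in
    let l := zvars b l in
    let a' := zreify a l in
    let b' := zreify b l in
    tac l a' b'
  end.

Ltac zmod := zmod_with ltac:(fun l a b =>
  exact: (@zeval_eq _ l a b isT)).

Ltac zmod2 h := zmod_with ltac:(fun l a b =>
  exact: (@zeval_eq2 _ l a b h isT)).

Lemma eq_from_sub (G : zmodType) (x y a b : G) : a = b -> x - y = a - b -> x = y.
Proof. by move=> ->; rewrite subrr => /subr0_eq. Qed.

Lemma eqD (G : zmodType) (x y a b : G) : x = y -> a = b -> x + a = y + b.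
Proof. by move=> -> ->. Qed.

Lemma eqN (G : zmodType) (x y : G) : x = y -> - x = - y.
Proof. by move=> ->. Qed.

Ltac zmod_by h := apply: (eq_from_sub h); zmod.

(* [lia] would treat convertible but syntactically distinct instances of [count]
   or [size] as different atoms. *)
Ltac gen_atoms :=
  repeat match goal with
    | |- context [@count ?T ?q ?s] => move: (@count T q s) => ?
    | |- context [@size ?T ?s] => move: (@size T s) => ?
    | |- context [nat_of_bool (?f ?b)] => move: (nat_of_bool (f b)) => ?
    end.

Ltac nlia :=
  repeat match goal with H : ?T |- _ =>
    lazymatch T with
    | nat => fail
    | is_true (leq _ _) => revert H
    | is_true (leq _ _ && leq _ _) => revert H
    | is_true (~~ leq _ _) => revert H
    | is_true (~~ (@eq_op _ (_ : nat) _)) => revert H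
    | @eq nat _ _ => revert H
    | _ => clear H
    end end; gen_atoms; lia.

Ltac permlia :=
  let p := fresh "p" in
  apply/seq.permP => p;
  repeat match goal with H : is_true (perm_eq _ _) |- _ =>
    move/seq.permP/(_ p): H; rewrite /= ?count_cat /= ?count_cat end;
  rewrite /= ?count_cat /= ?count_cat; clear; gen_atoms; lia.

Definition zsfree (G : zmodType) (k : nat) (S : seq G) : Prop :=
  forall T U : seq G, perm_eq S (T ++ U) -> size T = k -> \sum_(x <- T) x <> 0.

Lemma subseq_perm (T : eqType) (s t : seq T) :
  subseq s t -> exists u, perm_eq t (s ++ u).
Proof.
elim: t s => [|y t IH] [|x s] //=; try by exists [::].
- by exists (y :: t).
case: eqP => [->|_] /IH [u hu]; first by exists u; rewrite /= perm_cons.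
exists (y :: u); permlia.
Qed.

Lemma perm_subseq (T : eqType) (s t u : seq T) :
  perm_eq t (s ++ u) -> exists2 s', subseq s' t & perm_eq s s'.
Proof.
move=> h; apply/count_subseqP => x.
by move/seq.permP/(_ (pred1 x)): h; rewrite count_cat => ->; rewrite leq_addr.
Qed.

Lemma zsfreeP (G : finZmodType) k (S : seq G) :
  ~ has_zero_sum_subseq k S <-> zsfree k S.
Proof.
split=> [h T U hS hT hs|h [T [hT hk hs]]].
  have [T' hT' hp] := perm_subseq hS.
  by apply: h; exists T'; split=> //; rewrite -?(perm_size hp) // -(perm_big _ hp).
by have [U hU] := subseq_perm hT; apply: (h T U).
Qed.

Lemma zsfree_perm (G : zmodType) k (S S' : seq G) :
  perm_eq S S' -> zsfree k S -> zsfree k S'.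
Proof. by move=> h hS T U hT; apply: hS; apply: perm_trans h hT. Qed.

Lemma sum_map_add (G : zmodType) (c : G) (S : seq G) :
  \sum_(x <- [seq c + x | x <- S]) x = c *+ size S + \sum_(x <- S) x.
Proof. by rewrite big_map big_split /= big_const_seq count_predT iter_addr_0. Qed.

Lemma map_addK (G : zmodType) (c : G) (S : seq G) :
  [seq - c + x | x <- [seq c + x | x <- S]] = S.
Proof. by rewrite -map_comp map_id_in // => x _ /=; rewrite addKr. Qed.

Lemma zsfree_translate (G : zmodType) k (c : G) (S : seq G) :
  c *+ k = 0 -> zsfree k S -> zsfree k [seq c + x | x <- S].
Proof.
move=> hc hS T U hT sT hs.
apply: (hS [seq - c + x | x <- T] [seq - c + x | x <- U]); rewrite ?size_map //.
  by rewrite -map_cat -[S in perm_eq S _](map_addK c) perm_map.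
by rewrite sum_map_add sT mulNrn hc hs oppr0 addr0.
Qed.

Lemma sum_nseq (G : zmodType) k (x : G) : \sum_(y <- nseq k x) y = x *+ k.
Proof. by rewrite big_nseq iter_addr_0. Qed.

(** * The inverse Erdos-Ginzburg-Ziv theorem *)

Section Scherk.
Variable G : finZmodType.
Implicit Types (A B : {set G}) (x y : G).

Definition sumset A B : {set G} := [set a + b | a in A, b in B].

Lemma sumsetP A B x :
  reflect (exists a b, [/\ a \in A, b \in B & x = a + b]) (x \in sumset A B).
Proof.
apply: (iffP imset2P) => [[a b ha hb ->]|[a [b [ha hb ->]]]]; first by exists a, b.
by exists a b.
Qed.

Lemma closed_opp A x : (forall a, a \in A -> a + x \in A) ->
  forall a, a \in A -> a - x \in A.
Proof.
move=> h a ha; have hk k : a + x *+ k \in A.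
  elim: k => [|k IH]; first by rewrite mulr0n addr0.
  by rewrite mulrSr addrA; apply: h.
suff <- : x *+ #[x]%g.-1 = - x by apply: hk.
by apply/eqP; rewrite -addr_eq0 -mulrSr prednK ?order_gt0 // -FinRing.zmodXgE expg_order.
Qed.

(* The e-transform [A :|: (a + B)], [B :&: (A - a)] preserves the hypotheses
   and [|A| + |B|] and shrinks [B], unless [A] is invariant under [B]. *)
Lemma scherk A B : 0 \in A -> 0 \in B ->
  (forall a b, a \in A -> b \in B -> a + b = 0 -> a = 0) ->
  (#|A| + #|B| <= #|sumset A B|.+1)%N.
Proof.
have [m] := ubnP #|B|; elim: m A B => // m IH A B hm A0 B0 hAB.
have subA : A \subset sumset A B.
  by apply/subsetP => a ha; apply/sumsetP; exists a, 0; rewrite addr0.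
have [/exists_inP [b bB nb]|/exists_inPn sB] := boolP [exists b in B, b != 0]; last first.
  have eB : B = [set 0].
    by apply/setP => x; rewrite inE; apply/idP/eqP => [/sB/negPn/eqP|->].
  by rewrite {1}eB cards1 addn1 ltnS subset_leq_card.
have [/exists_inP [a aA /exists_inP [c cB ac]]|] :=
    boolP [exists a in A, exists c in B, a + c \notin A]; last first.
  move=> /exists_inPn hA.
  have hb a : a \in A -> a + b \in A.
    by move=> aA; have /exists_inPn h := hA _ aA; have := h _ bB; rewrite negbK.
  have := closed_opp hb A0; rewrite sub0r => /hAB /(_ bB).
  by rewrite addNr => /(_ erefl) /eqP; rewrite oppr_eq0 (negbTE nb).
pose aB := [set a + x | x in B]; pose A' := A :|: aB.
pose B' := [set x in B | a + x \in A].
have hB' : (#|A'| + #|B'| = #|A| + #|B|)%N.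
  have -> : #|B'| = #|A :&: aB|.
    rewrite -(card_imset B' (addrI a)); apply: eq_card => x.
    rewrite inE; apply/imsetP/andP => [[y]|[xA /imsetP [y yB xE]]].
      by rewrite inE => /andP [yB yA] ->; split=> //; apply: imset_f.
    by exists y => //; rewrite inE yB -xE.
  by rewrite cardsUI (card_imset _ (addrI a)).
have lB : (#|B'| < #|B|)%N.
  apply: proper_card; apply/properP; split.
    by apply/subsetP => x; rewrite inE => /andP [].
  by exists c => //; rewrite inE cB.
rewrite -hB'; apply: leq_trans (IH A' B' _ _ _ _) _.
- by apply: leq_trans lB _.
- by rewrite inE A0.
- by rewrite inE B0 addr0.
- move=> x y /setUP [xA|/imsetP [z zB ->]]; rewrite inE => /andP [yB ayA].
    exact: hAB.
  move=> h; have z0 : z = 0.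
    have h' : (a + y) + z = 0 by rewrite -h addrAC.
    by have h2 := hAB _ _ ayA zB h'; rewrite h2 add0r in h'.
  by rewrite z0 addr0 in h *; apply: hAB aA yB h.
- rewrite ltnS; apply: subset_leq_card; apply/subsetP => x /sumsetP [u [v [hu hv ->]]].
  move: hv; rewrite inE => /andP [vB avA]; apply/sumsetP.
  case/setUP: hu => [uA|/imsetP [z zB ->]]; first by exists u, v.
  by exists (a + v), z; split=> //; rewrite addrAC.
Qed.

End Scherk.

Lemma count_le_perm (T : eqType) (s t : seq T) :
  (forall x, (count_mem x s <= count_mem x t)%N) -> exists u, perm_eq t (s ++ u).
Proof.
move=> /count_subseqP [s' /subseq_perm [u hu] hs].
by exists u; rewrite (permPl hu) perm_cat2r perm_sym.
Qed.

Lemma zero_sum_dec (G : finZmodType) (p : pred nat) (S : seq G) :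
  (exists T U, [/\ perm_eq S (T ++ U), p (size T) & \sum_(x <- T) x = 0]) \/
  (forall k, p k -> zsfree k S).
Proof.
have [/existsP [m /andP [h1 /eqP h2]]|/existsPn h] :=
  boolP [exists m : (size S).-tuple bool,
    p (size (mask m S)) && (\sum_(x <- mask m S) x == 0)].
  by have [U hU] := subseq_perm (mask_subseq m S); left; exists (mask m S), U.
right=> k pk T U hS hk hT; have [S' /subseqP [m hm mE] hp] := perm_subseq hS.
have := h (Tuple (introT eqP hm)); rewrite /= -mE -(perm_size hp) hk pk /=.
by rewrite -(perm_big _ hp) hT eqxx.
Qed.

Lemma sum_count_mem (T : finType) (S : seq T) :
  (\sum_(x : T) count_mem x S = size S)%N.
Proof.
elim: S => [|y S IH] /=; first by rewrite big1.
rewrite big_split /= IH (bigD1 y) //= eqxx big1 ?addn0 ?add1n // => x.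
by rewrite eq_sym => /negbTE ->.
Qed.

Section Spread.
Variable G : finZmodType.
Implicit Types (A : {set G}) (As : seq {set G}) (R V : seq G).

Definition spread As : {set G} := foldr (fun A B => sumset (0 |: A) B) [set 0] As.

Lemma spread0 As : 0 \in spread As.
Proof.
elim: As => [|A As IH] /=; first by rewrite inE.
by apply/sumsetP; exists 0, 0; rewrite addr0 IH !inE eqxx.
Qed.

Lemma spreadP As x : x \in spread As -> exists V,
  [/\ forall g, (count_mem g V <= \sum_(A <- As) (g \in A))%N,
      (size V <= size As)%N & \sum_(y <- V) y = x].
Proof.
elim: As x => [|A As IH] x /=.
  by rewrite inE => /eqP ->; exists [::]; rewrite big_nil.
case/sumsetP => a [b [ha /IH [V [cV sV eV]] ->]].
case/setU1P: ha => [->|aA].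
  exists V; split=> [g||]; rewrite ?add0r //; last exact: leqW.
  by rewrite big_cons (leq_trans (cV g)) ?leq_addl.
exists (a :: V); split=> [g||] //=; last by rewrite big_cons eV.
rewrite big_cons leq_add //; case: eqP => // <-; by rewrite aA.
Qed.

Lemma spread_card As1 As2 R :
  (forall g, \sum_(A <- As1 ++ As2) (g \in A) <= count_mem g R)%N ->
  (forall k, 0 < k <= size (As1 ++ As2) -> zsfree k R)%N ->
  (\sum_(A <- As1) #|A| + #|spread As2| <= #|spread (As1 ++ As2)|)%N.
Proof.
elim: As1 => [|A As1 IH] hc hf /=; first by rewrite big_nil.
have nz V : (forall g, (count_mem g V <= \sum_(A <- A :: As1 ++ As2) (g \in A))%N) ->
    (0 < size V <= (size (As1 ++ As2)).+1)%N -> \sum_(x <- V) x <> 0.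
  move=> cV sV; have [U hU] : exists U, perm_eq R (V ++ U).
    by apply: count_le_perm => g; apply: leq_trans (cV g) (hc g).
  exact: (hf (size V) sV V U hU).
have A0 : 0 \notin A.
  apply/negP => A0; apply: (nz [:: 0]) => //; last by rewrite big_seq1.
  by move=> g /=; rewrite addn0 big_cons; case: eqP => // <-; rewrite A0.
have {}IH : (\sum_(A <- As1) #|A| + #|spread As2| <= #|spread (As1 ++ As2)|)%N.
  apply: IH => [g|k hk]; last by apply: hf; move: hk => /= ; lia.
  by apply: leq_trans (hc g); rewrite /= big_cons leq_addl.
have : (#|0%R |: A| + #|spread (As1 ++ As2)| <= #|spread (A :: As1 ++ As2)|.+1)%N.
  apply: scherk; rewrite ?spread0 ?setU11 // => a b ha hb hab.
  case/setU1P: ha => // aA; have [V [cV sV eV]] := spreadP hb.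
  case: (nz (a :: V)) => //=; last by rewrite big_cons eV.
  move=> g; rewrite big_cons leq_add //; case: eqP => // <-; by rewrite aA.
rewrite cardsU1 A0 big_cons add1n addSn ltnS; apply: leq_trans.
by rewrite -addnA leq_add2l.
Qed.

Lemma spread_sub (H : {set G}) As : 0 \in H ->
  (forall x y, x \in H -> y \in H -> x + y \in H) ->
  (forall A, A \in As -> A \subset H) -> spread As \subset H.
Proof.
move=> H0 HD; elim: As => [|A As IH] hA; first by rewrite sub1set.
apply/subsetP => x /sumsetP [a [b [ha hb ->]]]; apply: HD.
  by case/setU1P: ha => [->//|]; apply/subsetP/hA; rewrite inE eqxx.
move: b hb; apply/subsetP/IH => B hB; apply: hA; by rewrite inE hB orbT.
Qed.

Definition layer R i : {set G} := [set g | (i < count_mem g R)%N].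

Lemma sum_mem_layer R (g : G) k :
  (\sum_(0 <= i < k) (g \in layer R i) = minn k (count_mem g R))%N.
Proof.
elim: k => [|k IH]; first by rewrite big_nil min0n.
by rewrite big_nat_recr //= IH inE; move: (count_mem g R) => c; case: ltnP; lia.
Qed.

Lemma sum_card_layer R k : (forall g, count_mem g R <= k)%N ->
  (\sum_(0 <= i < k) #|layer R i| = size R)%N.
Proof.
move=> hk; rewrite -sum_count_mem.
under eq_bigr do rewrite -sum1_card big_mkcond /=.
rewrite exchange_big /=; apply: eq_bigr => g _.
under eq_bigr do rewrite -/(nat_of_bool _).
by rewrite -[RHS](minn_idPr (hk g)) -sum_mem_layer.
Qed.

End Spread.

Section EGZ.
Variables (G : finZmodType) (H : {set G}) (n : nat).
Hypotheses (H0 : 0 \in H) (HB : forall x y, x \in H -> y \in H -> x - y \in H).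
Hypothesis cardH : #|H| = n.

Let HD x y : x \in H -> y \in H -> x + y \in H.
Proof.
by move=> hx hy; rewrite -[y]opprK; apply: HB => //; rewrite -sub0r; apply: HB.
Qed.

Lemma mulrn_card x : x \in H -> x *+ n = 0.
Proof.
have gH : group_set H.
  by apply/group_setP; split=> // a b ha hb; rewrite FinRing.zmodMgE HD.
move=> xH; rewrite -cardH -FinRing.zmodXgE.
exact: (@expg_cardG _ (Group gH) x).
Qed.

(* The level sets of the multiplicity function of [R'] form [k] sets to which,
   together with [As], [spread_card] applies. *)
Lemma split_bound (As : seq {set G}) k (R V R' : seq G) :
  {subset R <= H} -> perm_eq R (V ++ R') ->
  (forall g, \sum_(A <- As) (g \in A) <= count_mem g V)%N ->
  (forall g, count_mem g R' <= k)%N ->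
  (forall j, 0 < j <= k + size As -> zsfree j R)%N ->
  (size R' + #|spread As| <= n)%N.
Proof.
move=> RH pR cV cR' fR.
pose As1 := [seq layer R' i | i <- index_iota 0 k].
have eAs1 g : (\sum_(A <- As1) (g \in A) = count_mem g R')%N.
  by rewrite big_map sum_mem_layer; apply/minn_idPr.
have hc g : (\sum_(A <- As1 ++ As) (g \in A) <= count_mem g R)%N.
  by rewrite big_cat eAs1 /= (seq.permP pR) count_cat addnC leq_add2r.
have <- : (\sum_(A <- As1) #|A| = size R')%N by rewrite big_map sum_card_layer.
rewrite -cardH; apply: leq_trans (@spread_card _ As1 As R hc _) _.
  by move=> j; rewrite size_cat size_map size_iota subn0; apply: fR.
apply/subset_leq_card/spread_sub => // A hA; apply/subsetP => g gA; apply: RH.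
rewrite -has_pred1 has_count; apply: leq_trans (hc g).
rewrite (perm_big _ (perm_to_rem hA)) big_cons gA //.
Qed.

Lemma short_free_size k (R : seq G) : {subset R <= H} ->
  (forall g, count_mem g R <= k)%N ->
  (forall j, 0 < j <= k -> zsfree j R)%N -> (size R < n)%N.
Proof.
move=> RH cR fR; have := @split_bound [::] k R [::] R RH (perm_refl _).
rewrite /= cards1 !addn1 addn0; apply=> // g; by rewrite big_nil.
Qed.

(* If [x] and [y] were distinct terms, [R] could be split into [k + 1] sets two of
   which have a sumset that is too large for [split_bound], unless the set [M] of
   terms of multiplicity [k] has at least two elements and [M :\ z] is stable
   under translation by [z] for all [z] in [M]; then [M] contains [- z] for all
   [z] in [M], and a zero-sum sequence of length at most 3. *)
Lemma short_free_const k (R : seq G) x y : {subset R <= H} -> (1 < k)%N ->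
  (forall g, count_mem g R <= k)%N ->
  (forall j, 0 < j <= k.+1 -> zsfree j R)%N -> (n <= (size R).+1)%N ->
  x \in R -> y \in R -> x = y.
Proof.
move=> RH k1 cR fR sR xR yR; apply/eqP/negPn/negP => nxy.
have fU V : uniq V -> {subset V <= R} -> (0 < size V <= k.+1)%N ->
    \sum_(z <- V) z <> 0.
  move=> uV sV hV; have [U hU] : exists U, perm_eq R (V ++ U).
    apply: count_le_perm => g; rewrite count_uniq_mem //.
    case: (boolP (g \in V)) => // /sV; by rewrite -has_pred1 has_count.
  exact: (fR _ hV V U hU).
have R0 z : z \in R -> z != 0.
  move=> zR; apply/eqP => z0; apply: (fU [:: z]) => //; last by rewrite big_seq1.
  by move=> t; rewrite inE => /eqP ->.
have R2 z t : z \in R -> t \in R -> z != t -> z + t != 0.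
  move=> zR tR nzt; apply/eqP => h; apply: (fU [:: z; t]).
  - by rewrite /= inE nzt.
  - by move=> u; rewrite !inE => /orP [] /eqP ->.
  - by rewrite /= ltnS ltnW.
  - by rewrite !big_cons big_nil addr0.
have [M ME] : exists M : {set G}, forall g, (g \in M) = (k <= count_mem g R)%N.
  by exists [set g | k <= count_mem g R]%N => g; rewrite inE.
have MR : {subset M <= R}.
  move=> z; rewrite ME -has_pred1 has_count; apply: leq_trans; exact: ltnW.
have M0 z : z \in M -> z != 0 by move=> /MR; apply: R0.
have M2 z t : z \in M -> t \in M -> z != t -> z + t != 0.
  by move=> /MR hz /MR; apply: R2.
have [/existsP [a /existsP [b /and3P [aM bM nab]]]|hM] :=
  boolP [exists a, exists b, [&& a \in M, b \in M & a != b]].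
  have step z t : z \in M -> t \in M :\ z -> t + z \in M :\ z.
    move=> zM /setD1P [ntz tM]; apply/negPn/negP => hn.
    have htz : t + z \notin M.
      apply: contra hn => h; rewrite !inE h andbT -subr_eq0 addrK; exact: M0.
    have [R' pR] : exists R', perm_eq R (enum M ++ R').
      apply: count_le_perm => g; rewrite count_uniq_mem ?enum_uniq // mem_enum.
      case: (boolP (g \in M)) => // /MR; by rewrite -has_pred1 has_count.
    have hb : (size R' + #|spread [:: [set z]; M :\ z]| <= n)%N.
      apply: (split_bound RH pR (k := k.-1)).
    - move=> g; rewrite !big_cons big_nil count_uniq_mem ?enum_uniq //.
      by rewrite mem_enum !inE; case: eqP => [->|] /=; rewrite ?zM ?addn0.
    - move=> g; have := cR g; have := seq.permP pR (pred1 g).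
      rewrite count_cat (count_uniq_mem g (enum_uniq M)) mem_enum ME.
      move: (count_mem g R) (count_mem g R') => c c'; clear -k1.
      by case: (leqP k c); nlia.
    - by rewrite addn2 prednK ?(ltnW k1).
    have := perm_size pR.
    rewrite size_cat -cardE => hs; move: hb.
    suff : (#|(t + z)%R |: (0%R |: M)| <= #|spread [:: [set z]; M :\ z]|)%N.
      rewrite !cardsU1 !inE (negbTE htz) orbF.
      have -> : 0 \in M = false by apply/negP => /M0; rewrite eqxx.
      rewrite (M2 _ _ tM zM ntz) [in X in (X <= _)%N]/= => h3 h4.
      have h5 := leq_trans (leq_add (leqnn (size R')) h3) h4;
      have aux r r' m p : (p <= r.+1)%N -> r = (m + r')%N ->
        (r' + (1 + (1 + m)) <= p)%N -> False by nlia.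
      exact: aux sR hs h5.
    apply: subset_leq_card; apply/subsetP => g.
    have sp u v : u \in 0 |: [set z] -> v \in 0 |: (M :\ z) ->
        u + v \in spread [:: [set z]; M :\ z].
      move=> hu hv; apply/sumsetP; exists u, v; split=> //.
      by apply/sumsetP; exists v, 0; rewrite addr0 set11.
    case/setU1P => [->|/setU1P [->|gM]].
    - by rewrite addrC sp // !inE ?eqxx ?orbT // ntz tM orbT.
    - exact: spread0.
    - have [->|ngz] := eqVneq g z.
        by have := sp z 0; rewrite addr0 !inE !eqxx orbT; apply.
      by have := sp 0 g; rewrite add0r !inE eqxx ngz gM orbT; apply.
  have cM : a + b \in M.
    by have := step b a bM; rewrite !inE nab aM => /(_ isT) /andP [].
  have nca : a + b != a by rewrite -subr_eq0 addrAC subrr add0r M0.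
  have ncb : a + b != b by rewrite -subr_eq0 addrK M0.
  have opp z t : z \in M -> t \in M -> z + t \in M -> z + t != z -> t != 0 -> - t \in M.
    move=> zM tM ztM nzt t0; have zM' : z \in M :\ (z + t).
      by rewrite !inE eq_sym nzt zM.
    have := closed_opp (fun w hw => step _ _ ztM hw) zM'.
    by rewrite opprD addrA subrr add0r => /setD1P [].
  have ha : - a \in M by rewrite (opp b) // 1?addrC // M0.
  have hb : - b \in M by rewrite (opp a) // M0.
  have selfopp z : z \in M -> - z \in M -> - z = z.
    by move=> zM nzM; apply/eqP/negPn/negP => /(M2 _ _ nzM zM); rewrite addNr eqxx.
  apply: (fU [:: a; b; a + b]).
  - by rewrite /= !inE negb_or nab eq_sym nca eq_sym ncb.
  - by move=> u; rewrite !inE => /or3P [] /eqP ->; apply: MR.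
  - by rewrite /= ltnS.
  - rewrite !big_cons big_nil addr0 -{2}(selfopp a) // -{2}(selfopp b) //.
    by rewrite -opprD addrA subrr.
have [u [v [uR vR nuv hu]]] : exists u v, [/\ u \in R, v \in R, u != v &
    forall g, g \in M -> g = u].
  have [/existsP [u uM]|/existsPn hM0] := boolP [exists u, u \in M]; last first.
    by exists x, y; split=> // g gM; have := hM0 g; rewrite gM.
  have hu g : g \in M -> g = u.
    move=> gM; apply/eqP/negPn/negP => ngu; case/negP: hM.
    by apply/existsP; exists g; apply/existsP; exists u; rewrite gM uM.
  have [eux|nux] := eqVneq u x.
    by exists u, y; split=> //; [apply: MR|rewrite eux].
  by exists u, x; split=> //; apply: MR.
have [R' pR] : exists R', perm_eq R ([:: u; v] ++ R').
  apply: count_le_perm => g; rewrite count_uniq_mem /= ?inE ?nuv //.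
  case: (boolP (g \in [:: u; v])) ; rewrite !inE; last by move/negbTE ->.
  by case/orP => /eqP ->; rewrite eqxx ?orbT; [move: uR|move: vR]; rewrite -has_pred1 has_count.
have hb : (size R' + #|spread [:: [set u]; [set v]]| <= n)%N.
  apply: (split_bound RH pR (k := k.-1)).
- by move=> g; rewrite !big_cons big_nil !inE ![g == _]eq_sym.
- have aux (b c : bool) r r' : ((k <= r)%N -> b) -> r = (b + (c + r'))%N ->
      (r <= k)%N -> (r' <= k.-1)%N by case: b; nlia.
  move=> g; apply: (aux (u == g) (v == g)) (seq.permP pR (pred1 g)) (cR g).
  by rewrite -ME => /hu ->.
- by rewrite addn2 prednK ?(ltnW k1).
have := perm_size pR; rewrite /= => hs; move: hb.
suff : (#|(u + v)%R |: (0%R |: (u |: [set v]))| <=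
    #|spread [:: [set u]; [set v]]|)%N.
  rewrite !cardsU1 !inE cards1 ![0 == _]eq_sym.
  rewrite (negbTE (R2 _ _ uR vR nuv)) !(negbTE (R0 _ _)) // (negbTE nuv).
  have -> : (u + v == u) = false by rewrite -subr_eq0 addrAC subrr add0r (negbTE (R0 _ _)).
  have -> : (u + v == v) = false by rewrite -subr_eq0 addrK (negbTE (R0 _ _)).
  rewrite /= => h3 h4.
  have h5 := leq_trans (leq_add (leqnn (size R')) h3) h4.
  have aux r r' p : (p <= r.+1)%N -> r = r'.+2 -> (r' + 4 <= p)%N -> False by nlia.
  exact: aux sR hs h5.
apply: subset_leq_card; apply/subsetP => g.
have sp a b : a \in 0 |: [set u] -> b \in 0 |: [set v] ->
    a + b \in spread [:: [set u]; [set v]].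
  move=> ha hc; apply/sumsetP; exists a, b; split=> //.
  by apply/sumsetP; exists b, 0; rewrite addr0 set11.
case/setU1P => [->|/setU1P [->|/set2P [] ->]].
- by rewrite sp // !inE eqxx ?orbT.
- exact: spread0.
- by have := sp u 0; rewrite addr0 !inE !eqxx orbT; apply.
- by have := sp 0 v; rewrite add0r !inE !eqxx orbT; apply.
Qed.

Lemma zsfree_nseq k (S U : seq G) x : zsfree k S -> x *+ k = 0 ->
  perm_eq S (nseq k x ++ U) -> False.
Proof. by move=> fS hx /fS; rewrite size_nseq sum_nseq => /(_ erefl). Qed.

Lemma perm_nseq_count (T : eqType) (x : T) (S : seq T) :
  perm_eq S (nseq (count_mem x S) x ++ [seq y <- S | y != x]).
Proof.
rewrite -(perm_filterC (pred1 x) S) perm_cat2r.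
by have /all_pred1P -> := filter_all (pred1 x) S; rewrite size_filter.
Qed.

(* Translate a term of maximal multiplicity [h] to 0. A zero-sum subsequence [W] of
   the nonzero terms that is as long as possible subject to [|W| < n - h] leaves a
   sequence [R] of [n - 1] terms without zero-sum subsequence of length at most
   [h + 1], so [R] is constant. *)
Theorem egz_inverse (S : seq G) : (1 < n)%N -> {subset S <= H} ->
  size S = (2 * n - 2)%N -> zsfree n S ->
  exists a x, [/\ a \in H, x \in H, forall d, (0 < d < n)%N -> x *+ d != 0 &
    perm_eq S (nseq n.-1 a ++ nseq n.-1 (a + x))].
Proof.
move=> n1 SH sS fS.
pose a := [arg max_(x > (0 : G)) count_mem x S].
have ha x : (count_mem x S <= count_mem a S)%N.
  by rewrite /a; case: arg_maxnP => //= i _; apply.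
move: a ha => a ha; set h := count_mem a S in ha.
have h0 : (0 < h)%N.
  by case: S sS {SH fS} @h ha => [|y S] /= sS; [nlia|move=> /(_ y); rewrite eqxx; apply: leq_trans].
have aS : a \in S by rewrite -has_pred1 has_count.
have aH := SH a aS.
pose S1 := [seq - a + x | x <- S].
have fS1 : zsfree n S1 by apply: zsfree_translate; rewrite // mulNrn mulrn_card // oppr0.
have c1 x : count_mem x S1 = count_mem (a + x) S.
  rewrite count_map; apply: eq_count => y /=.
  by rewrite addrC subr_eq addrC.
have S1H : {subset S1 <= H} by move=> x /mapP [y /SH yH ->]; rewrite addrC HB.
have := perm_nseq_count 0 S1; rewrite c1 addr0 -/h; set T := filter _ _ => pT.
have cT x : (count_mem x T <= h)%N.
  apply: leq_trans (ha (a + x)); rewrite -c1 (seq.permP pT) count_cat; exact: leq_addl.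
have TH : {subset T <= H} by move=> x; rewrite mem_filter => /andP [_ /S1H].
have hn : (h < n)%N.
  rewrite ltnNge; apply/negP => hn; apply: (@zsfree_nseq n S1 (nseq (h - n) 0 ++ T) 0 fS1).
    by rewrite mul0rn.
  by rewrite catA -nseqD subnKC.
have sT : size T = (2 * n - 2 - h)%N.
  by have := perm_size pT; rewrite size_cat size_nseq size_map sS; nlia.
have pad W R : perm_eq T (W ++ R) -> \sum_(x <- W) x = 0 ->
    (n - h <= size W <= n)%N -> False.
  move=> pW eW hW; apply: (fS1 (W ++ nseq (n - size W) 0) (nseq (h - (n - size W)) 0 ++ R)).
  - have e : nseq h (0 : G) = nseq (n - size W) 0 ++ nseq (h - (n - size W)) 0.
      rewrite -nseqD; congr nseq; nlia.
    rewrite e in pT; permlia.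
  - rewrite size_cat size_nseq; nlia.
  - by rewrite big_cat /= eW sum_nseq mul0rn addr0.
have [W [R [pW eW sR]]] : exists W R,
    [/\ perm_eq T (W ++ R), \sum_(x <- W) x = 0 & size R = n.-1].
  suff hj j W R : perm_eq T (W ++ R) -> \sum_(x <- W) x = 0 ->
      (n.-1 <= size R <= n.-1 + j)%N -> exists W R,
    [/\ perm_eq T (W ++ R), \sum_(x <- W) x = 0 & size R = n.-1].
    apply: (hj (size T) [::] T) => //; first by rewrite big_nil.
    rewrite sT; nlia.
  elim: j W R => [|j IH] W R pW eW hR; first by exists W, R; split=> //; nlia.
  have [sR|sR] := eqVneq (size R) n.-1; first by exists W, R.
  have := perm_size pW; rewrite size_cat sT => sWR.
  have [[V [U [pV hV eV]]]|fR] := zero_sum_dec (fun k => 0 < k <= h)%N R; last first.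
    suff : (size R < n)%N by nlia.
    apply: short_free_size fR => [x xR|x].
      by apply: TH; rewrite (perm_mem pW) mem_cat xR orbT.
    by apply: leq_trans (cT x); rewrite (seq.permP pW) count_cat leq_addl.
  have pW' : perm_eq T ((W ++ V) ++ U) by permlia.
  have eW' : \sum_(x <- W ++ V) x = 0 by rewrite big_cat /= eW eV addr0.
  have := perm_size pV; rewrite size_cat => sV.
  have [hWV|hWV] := leqP (n - h) (size (W ++ V)).
    by case: (pad _ _ pW' eW'); move: hWV; rewrite size_cat; nlia.
  apply: (IH _ _ pW' eW'); move: hWV; rewrite size_cat; nlia.
have sW : size W = (n.-1 - h)%N.
  by have := perm_size pW; rewrite size_cat sT; nlia.
have RT : {subset R <= T} by move=> x xR; rewrite (perm_mem pW) mem_cat xR orbT.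
have fR j : (0 < j <= h.+1)%N -> zsfree j R.
  move=> hj V U pV sV eV.
  have pW' : perm_eq T ((W ++ V) ++ U) by permlia.
  apply: (pad _ _ pW'); rewrite ?big_cat /= ?eW ?eV ?addr0 // size_cat; nlia.
have cR x y : x \in R -> y \in R -> x = y.
  have [h1|h1] := ltnP 1 h.
    apply: (@short_free_const h) => //; last by rewrite sR; nlia.
      by move=> z /RT /TH.
    by move=> z; apply: leq_trans (cT z); rewrite (seq.permP pW) count_cat leq_addl.
  have uS : uniq S.
    apply: count_mem_uniq => z; have := ha z; rewrite -has_pred1 has_count.
    by case: (count_mem z S) => [//|[//|c]]; nlia.
  have := uniq_leq_size (s2 := enum H) uS; rewrite -cardE cardH sS => hle.
  have {}hle : (2 * n - 2 <= n)%N by apply: hle => z /SH; rewrite mem_enum.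
  case: R sR {pW RT fR} => [|u [|v R]] //=; last by nlia.
  by rewrite !inE => _ /eqP -> /eqP ->.
case: R sR pW cR fR RT => [|x R] sR pW cR fR RT; first by move: sR => /=; nlia.
have eR : x :: R = nseq n.-1 x.
  rewrite -sR; apply/all_pred1P/allP => y hy; apply/eqP; apply: cR => //.
  by rewrite inE eqxx.
have xT : x \in T by apply: RT; rewrite inE eqxx.
have hE : h = n.-1.
  apply/eqP; rewrite eqn_leq -ltnS prednK ?(ltnW n1) // hn /=.
  apply: leq_trans (cT x); rewrite (seq.permP pW) count_cat eR count_nseq /= eqxx mul1n.
  exact: leq_addl.
have W0 : W = [::] by apply: size0nil; rewrite sW hE subnn.
rewrite W0 cat0s eR in pW; rewrite hE in pT.
have pS : perm_eq S1 (nseq n.-1 0 ++ nseq n.-1 x) by permlia.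
exists a, x; split=> // [|d hd|]; first exact: TH.
  apply/eqP => xd; apply: (fS1 (nseq d x ++ nseq (n - d) 0)
      (nseq (n.-1 - (n - d)) 0 ++ nseq (n.-1 - d) x)).
  - have ex : nseq n.-1 x = nseq d x ++ nseq (n.-1 - d) x.
      by rewrite -nseqD; congr nseq; nlia.
    have e0 : nseq n.-1 (0 : G) = nseq (n - d) 0 ++ nseq (n.-1 - (n - d)) 0.
      by rewrite -nseqD; congr nseq; nlia.
    rewrite ex e0 in pS; permlia.
  - rewrite size_cat !size_nseq; nlia.
  - by rewrite big_cat /= !sum_nseq xd mul0rn addr0.
have := perm_map (+%R a) pS.
have -> : [seq a + x | x <- S1] = S by have := map_addK (- a) S; rewrite opprK.
by rewrite map_cat !map_nseq addr0.
Qed.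

End EGZ.

(** * Pairs and quadruples modulo 2G *)

Lemma perm_split_nonuniq (T U : eqType) (f : T -> U) (s : seq T) :
  ~~ uniq [seq f x | x <- s] ->
  exists y z s', perm_eq s ([:: y; z] ++ s') /\ f y = f z.
Proof.
elim: s => //= x s IH; rewrite negb_and negbK => /orP [/mapP [z zs e]|/IH].
  by exists x, z, (rem z s); rewrite /= perm_cons perm_to_rem.
move=> [y [z [s' [hs e]]]]; exists y, z, (x :: s'); split=> //; permlia.
Qed.

Lemma perm_cons_mem (T : eqType) (x : T) (s : seq T) : x \in s ->
  exists s', perm_eq s (x :: s').
Proof. by move=> /perm_to_rem h; exists (rem x s). Qed.

Lemma uniq_map_inj (T U : eqType) (f : T -> U) (s : seq T) :
  uniq [seq f x | x <- s] -> {in s &, injective f}.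
Proof.
move=> us x y xs ys e; apply/eqP/negPn/negP => nxy.
have [s' hs] := perm_cons_mem xs; move: us.
rewrite (perm_uniq (perm_map f hs)) /= => /andP [/negP h _]; apply: h.
rewrite e map_f //; move: ys; rewrite (perm_mem hs) inE eq_sym (negbTE nxy).
by [].
Qed.

Lemma perm_map_split (T U : eqType) (f : T -> U) (s : seq T) (t u : seq U) :
  perm_eq [seq f x | x <- s] (t ++ u) ->
  exists s1 s2, [/\ perm_eq s (s1 ++ s2), [seq f x | x <- s1] = t &
    perm_eq [seq f x | x <- s2] u].
Proof.
elim: t s => [|y t IH] s h; first by exists [::], s.
have /mapP [x xs yE] : y \in [seq f x | x <- s] by rewrite (perm_mem h) mem_head.
have [s' hs] := perm_cons_mem xs; have := perm_map f hs; rewrite /= -yE => h'.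
have [s1 [s2 [h1 h2 h3]]] : exists s1 s2, [/\ perm_eq s' (s1 ++ s2),
    [seq f x | x <- s1] = t & perm_eq [seq f x | x <- s2] u].
  by apply: IH; rewrite -(perm_cons y) -(permPl h').
exists (x :: s1), s2; split=> //=; last by rewrite h2 yE.
by rewrite (permPl hs) perm_cons.
Qed.

Section Pairs.
Variable G : finZmodType.
Implicit Types (P : seq (G * G)) (S T U : seq G).

Definition psum P : seq G := [seq p.1 + p.2 | p <- P].
Definition pflat P : seq G := flatten [seq [:: p.1; p.2] | p <- P].

Lemma pflat_cat P P' : pflat (P ++ P') = pflat P ++ pflat P'.
Proof. by rewrite /pflat map_cat flatten_cat. Qed.

Lemma size_pflat P : size (pflat P) = (2 * size P)%N.
Proof. by elim: P => //= p P IH; rewrite /pflat /= -/(pflat P) IH mulnS. Qed.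

Lemma sum_pflat P : \sum_(x <- pflat P) x = \sum_(x <- psum P) x.
Proof.
elim: P => //= p P IH.
by rewrite /pflat /= -/(pflat P) !big_cons IH addrA.
Qed.

Lemma perm_pflat P P' : perm_eq P P' -> perm_eq (pflat P) (pflat P').
Proof. by move=> h; apply/perm_flatten/perm_map. Qed.

Lemma psum_split P T U : perm_eq (psum P) (T ++ U) ->
  exists P1 P2, [/\ perm_eq P (P1 ++ P2), psum P1 = T & perm_eq (psum P2) U].
Proof. exact: perm_map_split. Qed.

End Pairs.

(* [H] plays the role of [2G], and [pi] that of the projection [G -> G / 2G]. *)
Section Structure.
Variables (G : finZmodType) (H : {set G}) (n : nat).
Hypotheses (H0 : 0 \in H) (HB : forall x y, x \in H -> y \in H -> x - y \in H).
Hypotheses (cardH : #|H| = n) (n1 : (1 < n)%N).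
Variables (V : finZmodType) (pi : {additive G -> V}).
Hypotheses (cardV : #|V| = 8%N) (VV : forall v : V, v + v = 0).
Hypothesis (piH : forall x, (x \in H) = (pi x == 0)).
Variable S : seq G.
Hypothesis fS : zsfree (2 * n) S.
Implicit Types (P : seq (G * G)) (R Q L : seq G).

Let oppV (v : V) : - v = v.
Proof. by apply/eqP; rewrite eq_sym -addr_eq0 VV. Qed.

Let VD_eq0 (u v : V) : (u + v == 0) = (u == v).
Proof. by rewrite addr_eq0 oppV. Qed.

Let pairH x y : (x + y \in H) = (pi x == pi y).
Proof. by rewrite piH raddfD VD_eq0. Qed.

Let HD x y : x \in H -> y \in H -> x + y \in H.
Proof. by rewrite !piH raddfD => /eqP -> /eqP ->; rewrite addr0. Qed.

Let HN x : x \in H -> - x \in H.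
Proof. by rewrite !piH raddfN oppV. Qed.

Let Hsum (T : seq G) : {subset T <= H} -> \sum_(x <- T) x \in H.
Proof. by move=> hT; rewrite big_seq; apply: (big_ind (fun x => x \in H)). Qed.

Definition pairing R P :=
  perm_eq S (R ++ pflat P) /\ {in P, forall p, p.1 + p.2 \in H}.

Lemma pairing_sumH R P : pairing R P -> {subset psum P <= H}.
Proof. by case=> _ hP x /mapP [p pP ->]; apply: hP. Qed.

Lemma pairing_perm R R' P P' :
  perm_eq (R ++ pflat P) (R' ++ pflat P') ->
  {in P', forall p, p.1 + p.2 \in H} -> pairing R P -> pairing R' P'.
Proof. by move=> h h' [hS _]; split=> //; apply: perm_trans hS h. Qed.

Lemma pairing_free R P : pairing R P -> zsfree n (psum P).
Proof.
move=> [hS _] T U hT sT eT; have [P1 [P2 [hP e1 e2]]] := psum_split hT.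
apply: (fS (T := pflat P1) (U := R ++ pflat P2)).
- have := perm_pflat hP; rewrite pflat_cat => h; permlia.
- by rewrite size_pflat -sT -e1 size_map.
- by rewrite sum_pflat e1.
Qed.

Lemma pairing_move y z R P : pairing ([:: y; z] ++ R) P -> pi y = pi z ->
  pairing R ((y, z) :: P).
Proof.
move=> hP e; have hP2 := hP.2.
apply: pairing_perm hP; first by rewrite /pflat /= -/(pflat P); permlia.
move=> p; rewrite inE => /orP [/eqP -> /=|]; last exact: hP2.
by rewrite pairH e.
Qed.

Lemma pairing_quad Q R P : pairing (Q ++ R) P -> size Q = 4%N ->
  size P = (2 * n - 3)%N ->
  zsfree n (- \sum_(x <- psum P) x - \sum_(x <- Q) x :: psum P).
Proof.
move=> hP sQ sP T U hT sT eT; set q := _ - _ in hT.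
have [qT|qT] := boolP (q \in T); last first.
  have qU : q \in U by have := perm_mem hT q; rewrite inE eqxx mem_cat (negbTE qT).
  apply: (pairing_free hP (T := T) (U := rem q U)) => //.
  have pU := perm_to_rem qU; rewrite -(perm_cons q); permlia.
have pT := perm_to_rem qT; set T' := rem q T in pT.
have hU : perm_eq (psum P) (U ++ T') by rewrite -(perm_cons q); permlia.
have sU : size U = (n - 2)%N.
  have := perm_size hU; have := perm_size pT.
  rewrite size_cat size_map sP sT /=; nlia.
have [P1 [P2 [pP e1 e2]]] := psum_split hU.
case: hP => hS _; have := perm_pflat pP; rewrite pflat_cat => pf.
apply: (fS (T := Q ++ pflat P1) (U := R ++ pflat P2)); first by permlia.
  rewrite size_cat size_pflat sQ -(size_map (fun p => p.1 + p.2)) -/(psum P1) e1 sU; nlia.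
rewrite big_cat /= sum_pflat e1.
have h1 : \sum_(x <- psum P) x = \sum_(x <- U) x + \sum_(x <- T') x.
  by rewrite (perm_big _ hU) big_cat /=.
have h2 : q + \sum_(x <- T') x = 0 by move: eT; rewrite (perm_big _ pT) big_cons.
rewrite /q in h2.
zmod_by (eqN (eqD h1 h2)).
Qed.

Lemma egz_count (T : seq G) : {subset T <= H} -> size T = (2 * n - 2)%N ->
  zsfree n T -> forall g, g \in T -> count_mem g T = n.-1.
Proof.
move=> TH sT fT; have [a [x [_ _ hx hp]]] := egz_inverse H0 HB cardH n1 TH sT fT.
have x0 : x != 0 by have := hx 1%N; rewrite mulr1n n1; apply.
have nax : (a == a + x) = false by rewrite eq_sym -subr_eq0 addrAC subrr add0r (negbTE x0).
move=> g; rewrite (perm_mem hp) (seq.permP hp) count_cat !count_nseq mem_cat !mem_nseq /=.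
by case/orP => /andP [_ /eqP ->]; rewrite ?eqxx ?nax ?[a + x == a]eq_sym ?nax ?mul0n ?mul1n ?addn0.
Qed.

Lemma completion_uniq (T : seq G) w w' : {subset T <= H} -> size T = (2 * n - 3)%N ->
  w \in H -> w' \in H -> zsfree n (w :: T) -> zsfree n (w' :: T) -> w = w'.
Proof.
move=> TH sT wH wH' fw fw'; apply/eqP/negPn/negP => nww.
have sub u : u \in H -> {subset u :: T <= H}.
  by move=> uH x; rewrite inE => /orP [/eqP ->|/TH].
have sz u : size (u :: T) = (2 * n - 2)%N by rewrite /= sT; nlia.
have cnt u v : u \in H -> v \in H -> zsfree n (u :: T) -> zsfree n (v :: T) ->
    u != v -> count_mem u T = n.-2 /\ (n > 2 -> False)%N.
  move=> uH vH fu fv nuv.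
  have := egz_count (sub u uH) (sz u) fu (mem_head u T); rewrite /= eqxx add1n => cu.
  have {}cu : count_mem u T = n.-2 by rewrite -cu.
  split=> // n2; have uT : u \in T by rewrite -has_pred1 has_count cu; nlia.
  have := egz_count (sub v vH) (sz v) fv (g := u); rewrite inE uT orbT => /(_ isT).
  rewrite /= eq_sym (negbTE nuv) cu; nlia.
have [cw n2] := cnt w w' wH wH' fw fw' nww.
have nww' : w' != w by rewrite eq_sym.
have [cw' _] := cnt w' w wH' wH fw' fw nww'.
have {}n2 : n = 2%N by case: (ltngtP n 2) n1 n2 => // _ _ /(_ isT).
have [t tE] : exists t, T = [:: t].
  by case: T sT {TH sub sz cnt fw fw' cw cw'} => [|t [|]] //=; rewrite n2 // => _; exists t.
move: cw cw'; rewrite tE n2 /= !addn0 => /eqP; rewrite eqb0 => ntw /eqP; rewrite eqb0 => ntw'.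
have u3 : uniq [:: t; w; w'] by rewrite /= !inE negb_or ntw ntw' nww.
suff : (size [:: t; w; w'] <= size (enum H))%N by rewrite -cardE cardH n2.
apply: uniq_leq_size u3 _ => x; rewrite mem_enum !inE => /or3P [] /eqP -> //.
by apply: TH; rewrite tE mem_head.
Qed.

Lemma pairH_sum y z R P : pairing ([:: y; z] ++ R) P -> pi y = pi z ->
  zsfree n (y + z :: psum P) /\ y + z \in H.
Proof.
move=> hP e; split; last by rewrite pairH e.
by have := pairing_free (pairing_move hP e).
Qed.

Lemma quadH_sum Q R P : pairing (Q ++ R) P -> \sum_(x <- Q) x \in H ->
  - \sum_(x <- psum P) x - \sum_(x <- Q) x \in H.
Proof. by move=> /pairing_sumH/Hsum hP hQ; apply: HB => //; apply: HN. Qed.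

Lemma pair_pair y z y' z' R R' P : size P = (2 * n - 3)%N ->
  pairing ([:: y; z] ++ R) P -> pi y = pi z ->
  pairing ([:: y'; z'] ++ R') P -> pi y' = pi z' -> y + z = y' + z'.
Proof.
move=> sP hP e hP' e'; have [f h] := pairH_sum hP e; have [f' h'] := pairH_sum hP' e'.
by apply: completion_uniq h h' f f'; rewrite ?size_map //; apply: pairing_sumH hP.
Qed.

Lemma pair_quad y z Q R R' P : size P = (2 * n - 3)%N ->
  pairing ([:: y; z] ++ R) P -> pi y = pi z ->
  pairing (Q ++ R') P -> size Q = 4%N -> \sum_(x <- Q) x \in H ->
  \sum_(x <- Q) x = - \sum_(x <- (y + z :: psum P)) x.
Proof.
move=> sP hP e hP' sQ hQ; have [f h] := pairH_sum hP e.
have -> : \sum_(x <- y + z :: psum P) x = y + z + \sum_(x <- psum P) x.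
  by rewrite big_cons.
have := completion_uniq (pairing_sumH hP) _ h (quadH_sum hP' hQ) f (pairing_quad hP' sQ sP).
rewrite size_map => /(_ sP) h1; zmod_by h1.
Qed.

Lemma quad_quad Q Q' R R' P : size P = (2 * n - 3)%N ->
  pairing (Q ++ R) P -> size Q = 4%N -> \sum_(x <- Q) x \in H ->
  pairing (Q' ++ R') P -> size Q' = 4%N -> \sum_(x <- Q') x \in H ->
  \sum_(x <- Q) x = \sum_(x <- Q') x.
Proof.
move=> sP hP sQ hQ hP' sQ' hQ'.
have := completion_uniq (pairing_sumH hP) _ (quadH_sum hP hQ) (quadH_sum hP' hQ')
  (pairing_quad hP sQ sP) (pairing_quad hP' sQ' sP).
rewrite size_map => /(_ sP) h1; zmod_by (eqN h1).
Qed.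

Lemma fresh_class (s : seq V) : (size s < 8)%N -> exists v, v \notin s.
Proof.
move=> hs; have [/existsP //|/existsPn h] := boolP [exists v, v \notin s].
suff : (#|V| <= size s)%N by rewrite cardV leqNgt hs.
rewrite cardE; apply: uniq_leq_size (enum_uniq _) _ => v _.
by have := h v; rewrite negbK.
Qed.

Lemma sub_pairing Q R P : pairing R P -> uniq Q -> {subset Q <= R} ->
  exists R', perm_eq R (Q ++ R') /\ pairing (Q ++ R') P.
Proof.
move=> hP uQ sQ; have [R' hR] : exists R', perm_eq R (Q ++ R').
  apply: count_le_perm => g; rewrite count_uniq_mem //.
  by case: (boolP (g \in Q)) => // /sQ; rewrite -has_pred1 has_count.
by exists R'; split=> //; apply: (pairing_perm _ hP.2 hP); permlia.
Qed.

Lemma full_classes R : size R = 8%N -> uniq [seq pi x | x <- R] ->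
  forall v, v \in [seq pi x | x <- R].
Proof.
move=> sR uR v; apply/negPn/negP => hv.
suff : (size (v :: [seq pi x | x <- R]) <= size (enum V))%N.
  by rewrite /= size_map sR -cardE cardV.
by apply: uniq_leq_size => [|x]; rewrite ?mem_enum //= hv uR.
Qed.

Lemma full_doubles R P : pairing R P -> size P = (2 * n - 3)%N -> size R = 8%N ->
  uniq [seq pi x | x <- R] -> exists t, (forall g, g \in R -> g + g = t) /\
    (forall Q R', perm_eq R (Q ++ R') -> size Q = 4%N -> \sum_(x <- Q) x \in H ->
      \sum_(x <- Q) x = t + t).
Proof.
move=> hP sP sR uR; have injR := uniq_map_inj uR.
have full := full_classes sR uR.
pose r v := nth 0 R (index v [seq pi x | x <- R]).
have ri v : (index v [seq pi x | x <- R] < size R)%N by rewrite -(size_map pi) index_mem.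
have rR v : r v \in R by rewrite mem_nth.
have pr v : pi (r v) = v by rewrite -(nth_map 0 0) ?nth_index.
have rp g : g \in R -> r (pi g) = g by move=> gR; apply: injR; rewrite ?pr.
have sub Q : uniq Q -> {subset Q <= R} -> exists R', perm_eq R (Q ++ R') /\ pairing (Q ++ R') P.
  exact: sub_pairing.
have quadr a b e : a != b -> e != a -> e != b ->
    exists Q R', [/\ perm_eq R (Q ++ R'), pairing (Q ++ R') P, size Q = 4%N,
      \sum_(x <- Q) x \in H & \sum_(x <- Q) x = r a + r b + r e + r (e + a + b)].
  move=> nab nea neb.
  have uq : uniq [:: a; b; e; e + a + b].
    rewrite /= !inE !negb_or nab ![_ == e]eq_sym nea neb /=.
    have hN (x y z t : V) : t - x = - (y + z) -> (t == x) = (y == z).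
      by rewrite -subr_eq0 => ->; rewrite oppr_eq0 VD_eq0.
    have h1 : (a == e + a + b) = (e == b) by apply: hN; zmod.
    have h2 : (b == e + a + b) = (e == a) by apply: hN; zmod.
    have h3 : (e == e + a + b) = (a == b) by apply: hN; zmod.
    by rewrite h1 h2 h3 nab nea neb.
  have uQ : uniq [:: r a; r b; r e; r (e + a + b)].
    by rewrite -[[:: _; _; _; _]]/(map r [:: a; b; e; e + a + b]) (map_inj_uniq (can_inj pr)).
  have [|R' [h1 h2]] := sub _ uQ; first by move=> x; rewrite !inE => /or4P [] /eqP ->.
  exists [:: r a; r b; r e; r (e + a + b)], R'; split=> //.
    rewrite piH !big_cons big_nil !raddfD raddf0 !pr; apply/eqP; zmod2 VV.
  by rewrite !big_cons big_nil; zmod.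
have [q hq] : exists q, forall a b e, a != b -> e != a -> e != b ->
    r a + r b + r e + r (e + a + b) = q.
  have [u _] := @fresh_class [::] isT; have [v] := @fresh_class [:: u] isT.
  rewrite inE => nvu; have [w] := @fresh_class [:: u; v] isT; rewrite !inE negb_or.
  case/andP => nwu nwv; rewrite eq_sym in nvu.
  have [Q [R' [_ h1 h2 h3 h4]]] := quadr u v w nvu nwu nwv.
  exists (\sum_(x <- Q) x) => a b e h5 h6 h7.
  have [Q' [R'' [_ g1 g2 g3 <-]]] := quadr a b e h5 h6 h7.
  exact: quad_quad g1 g2 g3 h1 h2 h3.
have dbl u v : u != v -> r u + r u = r v + r v.
  move=> nuv; have [c] := @fresh_class [:: u; v] isT; rewrite !inE negb_or.
  case/andP => ncu ncv; have [e] := @fresh_class [:: c; u; v; c + u + v] isT.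
  rewrite !inE !negb_or => /and4P [nec neu nev ned].
  have nd (x y : V) : c != x -> y != c + y + x.
    move=> h; rewrite -subr_eq0.
    have -> : y - (c + y + x) = - (c + x) by zmod.
    by rewrite oppr_eq0 VD_eq0.
  have h1 := hq c v e ncv nec nev.
  have h2 := hq u (c + u + v) e (nd _ _ ncv) neu ned.
  have h3 := hq c u e ncu nec neu.
  have h4 := hq v (c + u + v) e _ nev ned.
  have e1 : e + u + (c + u + v) = e + c + v by zmod2 VV.
  have e2 : e + v + (c + u + v) = e + c + u by zmod2 VV.
  rewrite e1 in h2; rewrite e2 in h4.
  have {}h4 := h4 _; have {}h4 : r v + r (c + u + v) + r e + r (e + c + u) = q.
    apply: h4; have -> : c + u + v = c + v + u by zmod.
    exact: nd.
  zmod_by (eqD h2 (eqD (eqN h1) (eqD h3 (eqN h4)))).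
exists (r 0 + r 0); have rr v : r v + r v = r 0 + r 0.
  by have [->//|/dbl] := eqVneq v 0.
split=> [g /rp <-|Q R' hR sQ hQ]; first exact: rr.
have [u _] := @fresh_class [::] isT; have [v] := @fresh_class [:: u] isT.
rewrite inE => nvu; have [w] := @fresh_class [:: u; v] isT; rewrite !inE negb_or.
case/andP => nwu nwv; rewrite eq_sym in nvu.
have [e] := @fresh_class [:: u; v; w; w + u + v] isT; rewrite !inE !negb_or.
case/and4P => neu nev new ned.
have nwd : w != w + u + v.
  rewrite -subr_eq0; have -> : w - (w + u + v) = - (u + v) by zmod.
  by rewrite oppr_eq0 VD_eq0.
have h1 := hq u v e nvu neu nev; have h2 := hq w (w + u + v) e nwd new ned.
have h3 := hq u v w nvu nwu nwv.
have e1 : e + w + (w + u + v) = e + u + v by zmod2 VV.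
rewrite e1 in h2; have eu := rr u; have ev := rr v.
have [Q' [R'' [_ g1 g2 g3 g4]]] := quadr u v w nvu nwu nwv.
have hP' : pairing (Q ++ R') P by apply: (pairing_perm _ hP.2 hP); permlia.
rewrite (quad_quad sP hP' sQ hQ g1 g2 g3) g4.
zmod_by (eqD (eqN h1) (eqD h2 (eqD eu ev))).
Qed.

Lemma quad_through x R0 : size R0 = 7%N -> uniq [seq pi z | z <- x :: R0] ->
  exists Q0 R', [/\ perm_eq R0 (Q0 ++ R'), size Q0 = 3%N & x + \sum_(z <- Q0) z \in H].
Proof.
move=> sR uR; have full := @full_classes (x :: R0) (congr1 succn sR) uR.
have rep v : v != pi x -> exists2 g, g \in R0 & pi g = v.
  have := full v; rewrite inE => /orP [/eqP ->|/mapP [g gR ->] _]; first by rewrite eqxx.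
  by exists g.
have [u] := @fresh_class [:: pi x] isT; rewrite inE => nux.
have [v] := @fresh_class [:: pi x; u] isT; rewrite !inE negb_or => /andP [nvx nvu].
have [gu guR eu] := rep _ nux; have [gv gvR ev] := rep _ nvx.
have ndx : pi x + u + v != pi x.
  rewrite -subr_eq0; have -> : pi x + u + v - pi x = u + v by zmod.
  by rewrite VD_eq0 eq_sym.
have ndu : pi x + u + v != u.
  rewrite -subr_eq0; have -> : pi x + u + v - u = pi x + v by zmod.
  by rewrite VD_eq0 eq_sym.
have ndv : pi x + u + v != v.
  rewrite -subr_eq0; have -> : pi x + u + v - v = pi x + u by zmod.
  by rewrite VD_eq0 eq_sym.
have [gd gdR ed] := rep _ ndx.
have uQ : uniq [:: gu; gv; gd].
  have : uniq [seq pi z | z <- [:: gu; gv; gd]].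
    by rewrite /= !inE !negb_or eu ev ed ![_ == _ + _]eq_sym ndu ndv eq_sym nvu.
  exact: map_uniq.
have [R' hR'] : exists R', perm_eq R0 ([:: gu; gv; gd] ++ R').
  apply: count_le_perm => g; rewrite count_uniq_mem //.
  case: (boolP (g \in _)) => // hg.
  have : g \in R0 by move: hg; rewrite !inE => /or3P [] /eqP ->.
  by rewrite -has_pred1 has_count.
exists [:: gu; gv; gd], R'; split=> //.
rewrite piH !big_cons big_nil !raddfD raddf0 eu ev ed; apply/eqP; zmod2 VV.
Qed.

Lemma distinct8_false R P : pairing R P -> size P = (2 * n - 3)%N -> size R = 8%N ->
  uniq [seq pi x | x <- R] -> False.
Proof.
move=> hP sP sR uR; have [t [dR qR]] := full_doubles hP sP sR uR.
have inR y z P' : perm_eq (pflat P) (pflat ((y, z) :: P')) ->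
    {in (y, z) :: P', forall p, p.1 + p.2 \in H} -> (size P').+1 = size P -> y \in R.
  move=> hPP hH sP'; have eyz : pi y = pi z.
    by apply/eqP; rewrite -pairH; apply: (hH (y, z)); rewrite mem_head.
  have /mapP [x xR ex] := full_classes sR uR (pi y).
  have [R0 hR] := perm_cons_mem xR.
  have sR0 : size R0 = 7%N by have := perm_size hR; rewrite sR /= => - [].
  have uR0 : uniq [seq pi z | z <- x :: R0] by rewrite -(perm_uniq (perm_map pi hR)).
  have [Q0 [R' [hR0 sQ0 hQ0]]] := quad_through sR0 uR0.
  have hP1 : pairing (y :: R0) ((x, z) :: P').
    apply: pairing_perm hP.
      by move: hPP; rewrite /pflat /= -/(pflat P) -/(pflat P') => hPP; permlia.
    move=> p; rewrite inE => /orP [/eqP -> /=|pP']; first by rewrite pairH -ex eyz.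
    by apply: hH; rewrite inE pP' orbT.
  have uR1 : uniq [seq pi z | z <- y :: R0] by rewrite /= ex.
  have [||t1 [dR1 qR1]] := full_doubles hP1 _ _ uR1; rewrite /= ?sR0 ?sP' //.
  have [g gR0] : exists g, g \in R0.
    by case: R0 sR0 {hR uR0 hR0 hP1 uR1 dR1 qR1} => // g R0 _; exists g; rewrite mem_head.
  have tt : t = t1.
    by rewrite -(dR g) ?(perm_mem hR) ?inE ?gR0 ?orbT // (dR1 g) // inE gR0 orbT.
  have h1 := qR (x :: Q0) R' _; have h2 := qR1 (y :: Q0) R' _.
  rewrite /= !big_cons sQ0 in h1 h2.
  have hy : y + \sum_(z <- Q0) z \in H by move: hQ0; rewrite !piH !raddfD ex.
  have {}h1 := h1 _ erefl hQ0; have {}h2 := h2 _ erefl hy.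
  suff -> : y = x by [].
  apply: (addIr (\sum_(z <- Q0) z)); rewrite h1 ?h2 ?tt //; permlia.
have dP p : p \in P -> p.1 + p.2 = t.
  move=> pP; have [P' hP'] := perm_cons_mem pP; have hf := perm_pflat hP'.
  have hH : {in (p.1, p.2) :: P', forall q, q.1 + q.2 \in H}.
    by move=> q hq; apply: hP.2; rewrite (perm_mem hP'); case: p {pP} hP' hf hq.
  have hH' : {in (p.2, p.1) :: P', forall q, q.1 + q.2 \in H}.
    move=> q; rewrite inE => /orP [/eqP ->|qP'].
      by rewrite /= addrC; apply: (hH (p.1, p.2)); rewrite mem_head.
    by apply: hH; rewrite inE qP' orbT.
  have sP' := esym (perm_size hP').
  have h1 : p.1 \in R by apply: (inR p.1 p.2 P' _ hH sP'); exact: hf.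
  have h2 : p.2 \in R.
    apply: (inR p.2 p.1 P' _ hH' sP'); rewrite /pflat /= -/(pflat P').
    by move: hf; rewrite /pflat /= -/(pflat P) -/(pflat P') => hf; permlia.
  have -> : p.2 = p.1; last exact: dR.
  apply: (uniq_map_inj uR) => //; apply/eqP.
  by rewrite eq_sym -pairH; apply: hP.2.
have eP : psum P = nseq (2 * n - 3) t.
  rewrite -sP -(size_map (fun p => p.1 + p.2)); apply/all_pred1P/allP => g.
  by move=> /mapP [p pP ->] /=; rewrite dP.
case: R sR uR hP dR qR {inR dP} => // x R0 [sR0] uR hP dR qR.
have [Q0 [R' [hR0 sQ0 hQ0]]] := quad_through sR0 uR.
have hR : perm_eq (x :: R0) ((x :: Q0) ++ R') by permlia.
have hP' : pairing ((x :: Q0) ++ R') P by apply: (pairing_perm _ hP.2 hP); permlia.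
have := pairing_quad hP' (congr1 succn sQ0) sP.
rewrite (qR _ _ hR) ?big_cons //= ?sQ0 // eP sum_nseq.
have tH : t \in H by rewrite -(dR x (mem_head _ _)) piH raddfD VV.
have tn := mulrn_card H0 HB cardH tH.
have -> : - (t *+ (2 * n - 3)) - (t + t) = t.
  have e : t *+ (2 * n - 3) + t *+ 3 = 0.
    by rewrite -mulrnDr subnK; [rewrite mulnC mulrnA tn mul0rn|nlia].
  move: (t *+ (2 * n - 3)) e => u e; zmod_by (eqN e).
move=> h; apply: (zsfree_nseq h tn (U := nseq (n - 2) t)).
rewrite -nseqD -[t :: nseq _ _]/(nseq (2 * n - 3).+1 t).
suff -> : (2 * n - 3).+1 = (n + (n - 2))%N by [].
nlia.
Qed.

Definition closed_under (sg : V) (L : seq G) : Prop :=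
  uniq [seq pi z | z <- L] /\ forall x, x \in L -> exists2 y, y \in L & pi y = pi x + sg.

Lemma closed_under_split sg L : sg != 0 -> closed_under sg L -> (0 < size L)%N ->
  exists x y L', [/\ perm_eq L ([:: x; y] ++ L'), pi y = pi x + sg & closed_under sg L'].
Proof.
move=> sg0; case: L => // x L [uL cL] _; have [y yL ey] := cL x (mem_head _ _).
have nxy : y != x.
  apply: contraNneq sg0 => e; rewrite e in ey.
  by rewrite -(subrr (pi x)) {2}ey; apply/eqP; zmod2 VV.
move: yL; rewrite inE (negbTE nxy) /= => /perm_cons_mem [L' hL'].
have hL : perm_eq (x :: L) ([:: x; y] ++ L') by permlia.
exists x, y, L'; split=> //.
have uL' := uL; rewrite (perm_uniq (perm_map pi hL)) /= !inE negb_or in uL'.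
case/and3P: uL' => /andP [_ xL'] yL' uL'; split=> // g gL'.
have gL : g \in x :: L by rewrite (perm_mem hL) !inE gL' !orbT.
have [h hL2 eh] := cL g gL; exists h => //.
have eg : pi g = pi h + sg by rewrite eh; zmod2 VV.
move: hL2; rewrite (perm_mem hL) !inE => /or3P [/eqP e|/eqP e|//].
  by case/negP: yL'; rewrite ey -e -eg map_f.
case/negP: xL'; have -> : pi x = pi g by rewrite eg e ey; zmod2 VV.
exact: map_f.
Qed.

Lemma pairs_of_closed sg L : sg != 0 -> closed_under sg L -> size L = 6%N ->
  exists x1 y1 x2 y2 x3 y3, [/\ perm_eq L [:: x1; y1; x2; y2; x3; y3],
    pi y1 = pi x1 + sg, pi y2 = pi x2 + sg & pi y3 = pi x3 + sg].
Proof.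
move=> sg0 cL sL; have [|x1 [y1 [L1 [h1 e1 c1]]]] := closed_under_split sg0 cL.
  by rewrite sL.
have s1 := perm_size h1; rewrite sL /= in s1; case: s1 => s1.
have [|x2 [y2 [L2 [h2 e2 c2]]]] := closed_under_split sg0 c1; first by rewrite -s1.
have s2 := perm_size h2; rewrite -s1 /= in s2; case: s2 => s2.
have [|x3 [y3 [L3 [h3 e3 c3]]]] := closed_under_split sg0 c2; first by rewrite -s2.
have s3 := perm_size h3; rewrite -s2 /= in s3; case: s3 => s3.
exists x1, y1, x2, y2, x3, y3; split=> //.
by rewrite (size0nil (esym s3)) cats0 in h3; permlia.
Qed.

Lemma six_pairs L : size L = 6%N -> uniq [seq pi z | z <- L] ->
  exists sg x1 y1 x2 y2 x3 y3, [/\ perm_eq L [:: x1; y1; x2; y2; x3; y3],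
    [/\ pi y1 = pi x1 + sg, pi y2 = pi x2 + sg & pi y3 = pi x3 + sg] &
    forall c, c \notin [seq pi z | z <- L] -> c + sg \notin [seq pi z | z <- L] /\
      forall d, d != c -> d != c + sg -> d \in [seq pi z | z <- L]].
Proof.
move=> sL uL; set cl := [seq pi z | z <- L].
have scl : size cl = 6%N by rewrite size_map.
have [u uL'] : exists u, u \notin cl by apply: fresh_class; rewrite scl.
have [v] : exists v, v \notin u :: cl by apply: fresh_class; rewrite /= scl.
rewrite inE negb_or => /andP [nvu vL'].
have full d : d != u -> d != v -> d \in cl.
  move=> du dv; apply/negPn/negP => dcl.
  suff : (size [:: d, u, v & cl] <= size (enum V))%N by rewrite /= scl -cardE cardV.
  apply: uniq_leq_size => [|x]; last by rewrite mem_enum.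
  by rewrite /= !inE !negb_or du dv dcl eq_sym nvu uL' vL'.
have sg0 : u + v != 0 by rewrite VD_eq0 eq_sym.
have cL : closed_under (u + v) L.
  split=> // x xL; have xcl := map_f pi xL; suff /mapP [y yL ->] : pi x + (u + v) \in cl.
    by exists y.
  apply: full; apply: contraTneq xcl => e.
    have -> : pi x = v by apply: (eq_from_sub e); zmod2 VV.
    by [].
  have -> : pi x = u by apply: (eq_from_sub e); zmod2 VV.
  by [].
have [x1 [y1 [x2 [y2 [x3 [y3 [h e1 e2 e3]]]]]]] := pairs_of_closed sg0 cL sL.
exists (u + v), x1, y1, x2, y2, x3, y3; split=> // c cn.
have /orP [/eqP ->|/eqP ->] : (c == u) || (c == v).
  by apply: contraNT cn; rewrite negb_or => /andP [h1 h2]; apply: full.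
  have -> : u + (u + v) = v by zmod2 VV.
  by split=> // d du dv; apply: full.
have -> : v + (u + v) = u by zmod2 VV.
by split=> // d du dv; apply: full.
Qed.

Lemma zsfree_nseq2 g k : g \in H -> (n <= k)%N -> zsfree n (nseq k g) -> False.
Proof.
move=> gH nk h; apply: (zsfree_nseq h (mulrn_card H0 HB cardH gH) (U := nseq (k - n) g)).
by rewrite -nseqD subnKC.
Qed.

Lemma six_structure L P : pairing L P -> size L = 6%N -> size P = (2 * n - 2)%N ->
  exists a x s x1 y1 x2 y2 x3 y3 X,
  [/\ [/\ a \in H, x \in H & forall d, (0 < d < n)%N -> x *+ d != 0],
    [/\ x1 + y1 = s, x2 + y2 = s, x3 + y3 = s & s + s = a + (a + x)],
    uniq [seq pi z | z <- [:: x1; y1; x2; y2; x3; y3]],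
    {subset X <= [:: x1; y1; x2; y2; x3; y3]} /\
    perm_eq S ([:: x1; y1; x2; y2; x3; y3] ++ X ++ X) &
    perm_eq [seq z + z | z <- X] (nseq n.-1 a ++ nseq n.-1 (a + x))].
Proof.
move=> hP sL sP.
have split_pair p : p \in P -> exists P', [/\ perm_eq P (p :: P'), size P' = (2 * n - 3)%N,
    pairing ([:: p.1; p.2] ++ L) P', pairing ([:: p.2; p.1] ++ L) P' & pi p.1 = pi p.2].
  move=> pP; have [P' hP'] := perm_cons_mem pP; exists P'.
  have hf := perm_pflat hP'; rewrite /pflat /= -/(pflat P) -/(pflat P') in hf.
  have hH : {in P', forall q, q.1 + q.2 \in H}.
    by move=> q hq; apply: hP.2; rewrite (perm_mem hP') inE hq orbT.
  split=> //.
  - by have := perm_size hP'; rewrite sP /=; nlia.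
  - by apply: (pairing_perm _ hH hP); permlia.
  - by apply: (pairing_perm _ hH hP); permlia.
  - by apply/eqP; rewrite -pairH; apply: hP.2.
have fP := pairing_free hP; have PH := pairing_sumH hP.
have sPs : size (psum P) = (2 * n - 2)%N by rewrite size_map.
have uL : uniq [seq pi z | z <- L].
  apply/negPn/negP => /perm_split_nonuniq [y [z [L' [hL e]]]].
  apply: (@zsfree_nseq2 (y + z) (2 * n - 2)); first by rewrite pairH e.
    nlia.
  suff <- : psum P = nseq (2 * n - 2) (y + z) by [].
  rewrite -sPs; apply/all_pred1P/allP => g /mapP [p pP ->] /=; apply/eqP.
  have [P' [hP' sP' h1 _ e1]] := split_pair p pP.
  have h2 : pairing ([:: y; z] ++ ([:: p.1; p.2] ++ L')) P'.
    by apply: (pairing_perm _ h1.2 h1); permlia.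
  exact: pair_pair sP' h1 e1 h2 e.
have [a [x [aH xH hx hp]]] := egz_inverse H0 HB cardH n1 PH sPs fP.
have x0 : x != 0 by have := hx 1%N; rewrite mulr1n n1; apply.
have pred_mul g : g \in H -> g *+ n.-1 = - g.
  move=> gH; apply/eqP; rewrite -addr_eq0 -mulrSr prednK ?(ltnW n1) //.
  by rewrite (mulrn_card H0 HB cardH gH).
have sumP : - \sum_(z <- psum P) z = a + (a + x).
  rewrite (perm_big _ hp) big_cat /= !sum_nseq !pred_mul ?HD //; zmod.
have quad p Q R' : p \in P -> perm_eq ([:: p.1; p.2] ++ L) (Q ++ R') -> size Q = 4%N ->
    \sum_(z <- Q) pi z = 0 -> \sum_(z <- Q) z = a + (a + x).
  move=> pP hQ sQ eQ; have [P' [hP' sP' h1 _ e1]] := split_pair p pP.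
  have h2 : pairing (Q ++ R') P' by apply: (pairing_perm _ h1.2 h1); permlia.
  have QH : \sum_(z <- Q) z \in H by rewrite piH raddf_sum eQ.
  rewrite (pair_quad sP' h1 e1 h2 sQ QH) -sumP.
  have h3 : perm_eq (psum P) (p.1 + p.2 :: psum P') := perm_map _ hP'.
  by rewrite (perm_big _ h3).
have [sg [x1 [y1 [x2 [y2 [x3 [y3 [hL [e1 e2 e3] hcl]]]]]]]] := six_pairs sL uL.
have [p0 p0P] : exists p, p \in P.
  case: P sP {hP split_pair fP PH sPs hp sumP quad} => [|p P] /=; first by nlia.
  by exists p; rewrite mem_head.
have q12 : \sum_(z <- [:: x1; y1; x2; y2]) z = a + (a + x).
  apply: (quad p0 _ [:: p0.1; p0.2; x3; y3]) => //; first by permlia.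
  rewrite !big_cons big_nil e1 e2; zmod2 VV.
have q13 : \sum_(z <- [:: x1; y1; x3; y3]) z = a + (a + x).
  apply: (quad p0 _ [:: p0.1; p0.2; x2; y2]) => //; first by permlia.
  rewrite !big_cons big_nil e1 e3; zmod2 VV.
have q23 : \sum_(z <- [:: x2; y2; x3; y3]) z = a + (a + x).
  apply: (quad p0 _ [:: p0.1; p0.2; x1; y1]) => //; first by permlia.
  rewrite !big_cons big_nil e2 e3; zmod2 VV.
rewrite !big_cons big_nil in q12 q13 q23.
have s2 : x2 + y2 = x1 + y1 by zmod_by (eqD q23 (eqN q13)).
have s3 : x3 + y3 = x1 + y1 by zmod_by (eqD q23 (eqN q12)).
have ss : (x1 + y1) + (x1 + y1) = a + (a + x) by zmod_by (eqD q12 (eqN s2)).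
have key p : p \in P -> p.1 = p.2 /\ p.1 \in L.
  move=> pP; have [P' [hP' sP' h1 h1' e]] := split_pair p pP.
  have [/mapP [g gL eg]|cn] := boolP (pi p.1 \in [seq pi z | z <- L]).
    have [L' hL'] := perm_cons_mem gL.
    have h2 : pairing ([:: g; p.1] ++ (p.2 :: L')) P'.
      by apply: (pairing_perm _ h1.2 h1); permlia.
    have h3 : pairing ([:: g; p.2] ++ (p.1 :: L')) P'.
      by apply: (pairing_perm _ h1.2 h1); permlia.
    have k2 := pair_pair sP' h1 e h2 (esym eg).
    have k3 := pair_pair sP' h1 e h3 (etrans (esym eg) e).
    have k4 : p.1 = g by zmod_by k3.
    have k5 : p.2 = g by zmod_by k2.
    by rewrite k4 k5.
  exfalso; have [cs hd] := hcl _ cn.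
  have contra u v : perm_eq L [:: x1; y1; x2; y2; u; v] -> u + v = x1 + y1 ->
      pi u = pi p.1 + pi x1 + pi x2 -> pi v = pi u + sg -> False.
    move=> hL' euv eu ev.
    have k1 : \sum_(z <- [:: p.1; x1; x2; u]) z = a + (a + x).
      apply: (quad p _ [:: p.2; y1; y2; v] pP) => //; first by permlia.
      rewrite !big_cons big_nil eu; zmod2 VV.
    have k2 : \sum_(z <- [:: p.1; x1; y2; v]) z = a + (a + x).
      apply: (quad p _ [:: p.2; y1; x2; u] pP) => //; first by permlia.
      rewrite !big_cons big_nil ev eu e2; zmod2 VV.
    have k3 : \sum_(z <- [:: p.1; y1; x2; v]) z = a + (a + x).
      apply: (quad p _ [:: p.2; x1; y2; u] pP) => //; first by permlia.
      rewrite !big_cons big_nil ev eu e1; zmod2 VV.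
    have k4 : \sum_(z <- [:: p.1; y1; y2; u]) z = a + (a + x).
      apply: (quad p _ [:: p.2; x1; x2; v] pP) => //; first by permlia.
      rewrite !big_cons big_nil eu e1 e2; zmod2 VV.
    have k5 : \sum_(z <- [:: p.2; x1; x2; u]) z = a + (a + x).
      apply: (quad p _ [:: p.1; y1; y2; v] pP) => //; first by permlia.
      rewrite !big_cons big_nil eu -e; zmod2 VV.
    rewrite !big_cons !big_nil in k1 k2 k3 k4 k5.
    have ep : p.2 = p.1 by zmod_by (eqD k5 (eqN k1)).
    have dbl : (p.1 + p.2) + (p.1 + p.2) = a + (a + x).
      have k1234 := eqD k1 (eqD k2 (eqD k3 k4)).
      have s6 := eqD (eqD s2 s2) (eqD (eqD euv euv) (eqD ss (eqD ss ss))).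
      rewrite ep; zmod_by (eqD k1234 (eqN s6)).
    have /(map_f (fun q => q.1 + q.2)) := pP; rewrite -/(psum P) (perm_mem hp) mem_cat !mem_nseq.
    case/orP => /andP [_ /eqP e0]; rewrite e0 in dbl; case/negP: x0; apply/eqP.
      zmod_by (eqN dbl).
    zmod_by dbl.
  have cl := perm_mem (perm_map pi hL).
  have ncl z : z \in [:: x1; y1; x2; y2; x3; y3] -> (pi p.1 == pi z) = false.
    by move=> zL; apply: contraNF cn => /eqP ->; rewrite cl map_f.
  have nscl z : z \in [:: x1; y1; x2; y2; x3; y3] -> (pi p.1 + sg == pi z) = false.
    by move=> zL; apply: contraNF cs => /eqP ->; rewrite cl map_f.
  have u6 : uniq [seq pi z | z <- [:: x1; y1; x2; y2; x3; y3]].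
    by rewrite -(perm_uniq (perm_map pi hL)).
  have [n1y n12 n1y2] : [/\ pi x1 != pi y1, pi x1 != pi x2 & pi x1 != pi y2].
    by move: u6; rewrite /= !inE !negb_or => /andP [/and5P [-> -> -> _ _] _].
  pose d := pi p.1 + pi x1 + pi x2.
  have eqd (u w : V) : d - u = w -> (d == u) = (w == 0) by move=> <-; rewrite subr_eq0.
  have dL : d \in [seq pi z | z <- L].
    apply: hd; rewrite /d.
      rewrite (eqd _ (pi x1 + pi x2)) ?VD_eq0 //; rewrite /d; zmod.
    rewrite (eqd _ (pi x1 + pi y2)) ?VD_eq0 //; rewrite /d e2; zmod2 VV.
  have nd z w : w \in [:: x1; y1; x2; y2; x3; y3] ->
      (d - pi z = pi p.1 + pi w \/ d - pi z = pi p.1 + sg + pi w) -> (d == pi z) = false.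
    by move=> wL [] /eqd ->; rewrite VD_eq0 ?ncl ?nscl.
  have d1 : (d == pi x1) = false.
    by apply: (nd _ x2); [rewrite !inE eqxx !orbT|left; rewrite /d; zmod].
  have d2 : (d == pi y1) = false.
    by apply: (nd _ x2); [rewrite !inE eqxx !orbT|right; rewrite /d e1; zmod2 VV].
  have d3 : (d == pi x2) = false.
    by apply: (nd _ x1); [rewrite !inE eqxx|left; rewrite /d; zmod].
  have d4 : (d == pi y2) = false.
    by apply: (nd _ x1); [rewrite !inE eqxx|right; rewrite /d e2; zmod2 VV].
  move: dL; rewrite cl /= !inE d1 d2 d3 d4 /= => /orP [] /eqP ed.
    exact: (contra x3 y3).
  apply: (contra y3 x3) => //; first by permlia.
    by rewrite addrC.
  by rewrite e3; zmod2 VV.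
pose X := [seq p.1 | p <- P].
have flatE (Q : seq (G * G)) : {subset Q <= P} ->
    perm_eq (pflat Q) ([seq p.1 | p <- Q] ++ [seq p.1 | p <- Q]).
  elim: Q => // p Q IH hQ.
  have {}IH := IH (fun q hq => hQ q (@mem_behead _ (p :: Q) q hq)).
  rewrite /pflat /= -/(pflat Q) -(key p (hQ p (mem_head _ _))).1; permlia.
exists a, x, (x1 + y1), x1, y1, x2, y2, x3, y3, X; split=> //.
- by rewrite -(perm_uniq (perm_map pi hL)).
- split; first by move=> z /mapP [p pP ->]; rewrite -(perm_mem hL); case: (key p pP).
  have [hS _] := hP; have := flatE P (fun q hq => hq) => hf; rewrite /X; permlia.
- rewrite /X -map_comp; move: hp; congr (perm_eq _ _); apply/eq_in_map => p pP /=.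
  by case: (key p pP) => <-.
Qed.

Theorem zsfree_structure : size S = (4 * n + 2)%N ->
  exists a x s x1 y1 x2 y2 x3 y3 X,
  [/\ [/\ a \in H, x \in H & forall d, (0 < d < n)%N -> x *+ d != 0],
    [/\ x1 + y1 = s, x2 + y2 = s, x3 + y3 = s & s + s = a + (a + x)],
    uniq [seq pi z | z <- [:: x1; y1; x2; y2; x3; y3]],
    {subset X <= [:: x1; y1; x2; y2; x3; y3]} /\
    perm_eq S ([:: x1; y1; x2; y2; x3; y3] ++ X ++ X) &
    perm_eq [seq z + z | z <- X] (nseq n.-1 a ++ nseq n.-1 (a + x))].
Proof.
move=> sS; have exP k : (2 * k + 7 <= size S)%N -> exists R P, pairing R P /\ size P = k.
  elim: k => [_|k IH hk]; first by exists S, [::]; split=> //; split; rewrite ?cats0.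
  have [|R [P [hP sP]]] := IH; first by nlia.
  have sR : (8 < size R)%N.
    by have := perm_size hP.1; rewrite size_cat size_pflat sP; nlia.
  have : ~~ uniq [seq pi z | z <- R].
    apply/negP => uR; have : (size [seq pi z | z <- R] <= size (enum V))%N.
      by apply: uniq_leq_size uR _ => z _; rewrite mem_enum.
    by rewrite size_map -cardE cardV leqNgt sR.
  case/perm_split_nonuniq => y [z [R' [hR e]]].
  exists R', ((y, z) :: P); split; last by rewrite /= sP.
  by apply: pairing_move e; apply: (pairing_perm _ hP.2 hP); permlia.
have [|R [P [hP sP]]] := exP (2 * n - 3)%N; first by rewrite sS; nlia.
have sR : size R = 8%N.
  by have := perm_size hP.1; rewrite size_cat size_pflat sP sS; nlia.
have [uR|] := boolP (uniq [seq pi z | z <- R]).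
  by case: (distinct8_false hP sP sR uR).
case/perm_split_nonuniq => y [z [L [hR e]]].
have hL : pairing L ((y, z) :: P).
  by apply: pairing_move e; apply: (pairing_perm _ hP.2 hP); permlia.
apply: six_structure hL _ _; last by rewrite /= sP; nlia.
by have := perm_size hR; rewrite sR /= => - [].
Qed.

End Structure.

(** * Bases and the normal form *)

Section Basis.
Variables (G : finZmodType) (H : {set G}) (n : nat).
Hypotheses (H0 : 0 \in H) (HB : forall x y, x \in H -> y \in H -> x - y \in H).
Hypotheses (cardH : #|H| = n) (n1 : (1 < n)%N).
Variables (V : finZmodType) (pi : {additive G -> V}).
Hypotheses (cardV : #|V| = 8%N) (VV : forall v : V, v + v = 0).
Hypothesis (piH : forall x, (x \in H) = (pi x == 0)).

Definition indep (p q r : V) : Prop :=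
  0 \notin [:: p; q; r; p + q; p + r; q + r; p + q + r].

Lemma indepP p q r : indep p q r <->
  [/\ p != 0, q != 0, r != 0 & [/\ p + q != 0, p + r != 0, q + r != 0 & p + q + r != 0]].
Proof.
rewrite /indep !inE !negb_or ![0 == _]eq_sym.
by split=> [/and5P [-> -> -> -> /and3P []]|[-> -> -> [-> -> -> ->]]].
Qed.

Lemma indep_swap p q r : indep p q r -> indep q p r.
Proof.
case/indepP => h1 h2 h3 [h4 h5 h6 h7]; apply/indepP; split=> //; split=> //.
  by rewrite addrC.
by rewrite (addrC q).
Qed.

Lemma indep_rot p q r : indep p q r -> indep q r p.
Proof.
case/indepP => h1 h2 h3 [h4 h5 h6 h7]; apply/indepP; split=> //; split=> //.
- by rewrite addrC.
- by rewrite addrC.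
- by rewrite addrC addrA.
Qed.

Lemma indep_add p q r : indep p q r -> indep p q (r + p).
Proof.
case/indepP => h1 h2 h3 [h4 h5 h6 h7]; apply/indepP; split=> //.
  by rewrite addrC.
split=> //.
- by have -> : p + (r + p) = r by zmod2 VV.
- by have -> : q + (r + p) = p + q + r by zmod2 VV.
- by have -> : p + q + (r + p) = q + r by zmod2 VV.
Qed.

Lemma indep_addMn p q r k : indep p q r -> indep p q (r + p *+ k).
Proof.
by move=> h; elim: k => [|k IH]; rewrite ?mulr0n ?addr0 // mulrSr addrA; apply: indep_add.
Qed.

Lemma two_torsion_mulz (W : zmodType) (f : W) (k : int) : f + f = 0 ->
  f *~ k = f *+ odd `|k|%N.
Proof.
move=> ff; have hk m : f *+ m = f *+ odd m.
  by rewrite -{1}(odd_double_half m) mulrnDr -muln2 mulnC mulrnA mulr2n ff mul0rn addr0.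
case: k => m; first by rewrite -pmulrn hk.
have nf : - f = f by apply/eqP; rewrite eq_sym -addr_eq0 ff.
rewrite NegzE mulrNz -pmulrn hk abszN /=.
by case: (~~ odd m); rewrite ?mulr1n ?mulr0n ?oppr0 ?nf.
Qed.

Lemma indep_eq0 p q r (a b c : bool) : indep p q r ->
  p *+ a + q *+ b + r *+ c = 0 -> [/\ a = false, b = false & c = false].
Proof.
case/indepP => h1 h2 h3 [h4 h5 h6 h7].
by case: a; case: b; case: c; rewrite ?mulr1n ?mulr0n ?addr0 ?add0r // => /eqP e;
  move: h1 h2 h3 h4 h5 h6 h7; rewrite e.
Qed.

Lemma indep_span p q r v : indep p q r ->
  exists a b c : bool, v = p *+ a + q *+ b + r *+ c.
Proof.
move=> hi; pose F (t : bool * bool * bool) := p *+ t.1.1 + q *+ t.1.2 + r *+ t.2.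
have injF : injective F.
  move=> [[a b] c] [[a' b'] c'] e.
  have h0 (u : V) (d d' : bool) : u *+ (d (+) d') = u *+ d + u *+ d'.
    by case: d; case: d'; rewrite ?mulr1n ?mulr0n ?addr0 ?add0r ?VV.
  have := @indep_eq0 p q r (a (+) a') (b (+) b') (c (+) c') hi.
  rewrite !h0; case.
    by rewrite /F /= in e; move: (p *+ a) (p *+ a') (q *+ b) (q *+ b') (r *+ c) (r *+ c') e
      => p1 p2 q1 q2 r1 r2 e; apply: (eq_from_sub e); zmod2 VV.
  have xorF (d d' : bool) : d (+) d' = false -> d = d' by case: d; case: d'.
  by move=> /xorF -> /xorF -> /xorF ->.
have [|F' _ FK] := inj_card_bij injF; first by rewrite !card_prod !card_bool cardV.
by exists (F' v).1.1, (F' v).1.2, (F' v).2; have := FK v.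
Qed.

Variable x : G.
Hypotheses (xH : x \in H) (ordx : forall d, (0 < d < n)%N -> x *+ d != 0).

Let xn : x *+ n = 0. Proof. exact: (mulrn_card H0 HB cardH xH). Qed.

Lemma mulrn_eq0_dvd k : x *+ k = 0 -> (n %| k)%N.
Proof.
move=> h; have n0 : (0 < n)%N by apply: ltnW.
have e : x *+ (k %% n) = 0.
  by move: h; rewrite {1}(divn_eq k n) mulrnDr mulnC mulrnA xn mul0rn add0r.
apply/negPn/negP => nk; have := @ordx (k %% n)%N; rewrite e eqxx ltn_pmod //.
by rewrite lt0n nk => /(_ isT).
Qed.

Lemma H_cyclic h : h \in H -> exists2 k, (k < n)%N & h = x *+ k.
Proof.
move=> hH; pose F (i : 'I_n) := x *+ i.
have injF : injective F.
  move=> i j; wlog le_ij : i j / (i <= j)%N.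
    by move=> w e; case/orP: (leq_total i j) => l; [|apply/esym]; apply: w.
  move=> e; have : x *+ (j - i) = 0.
    by rewrite mulrnBr // -/(F i) -/(F j) e subrr.
  move=> /mulrn_eq0_dvd d; apply/val_inj/eqP; rewrite /= eqn_leq le_ij /= -subn_eq0.
  have lj := ltn_ord j; case: (posnP (j - i)) => [//|p].
  by have := dvdn_leq p d; rewrite leqNgt (leq_ltn_trans (leq_subr i j) lj).
have sub : [set F i | i : 'I_n] \subset H.
  apply/subsetP => g /imsetP [i _ ->]; rewrite piH /F raddfMn /=.
  by move: xH; rewrite piH => /eqP ->; rewrite mul0rn.
have /eqP eH : [set F i | i : 'I_n] == H.
  by rewrite eqEcard sub cardH card_imset // card_ord leqnn.
by move: hH; rewrite -eH => /imsetP [i _ ->]; exists i.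
Qed.

Lemma basis_of_indep f1 f2 f3 : f1 + f1 = 0 -> f2 + f2 = 0 -> f3 + f3 = x ->
  indep (pi f1) (pi f2) (pi f3) ->
  [/\ group_basis [:: f1; f2; f3], #[f1]%g = 2%N, #[f2]%g = 2%N & #[f3]%g = (2 * n)%N].
Proof.
move=> h1 h2 h3 hi; have /indepP [n1' n2' n3' _] := hi.
have piz f (k : int) : pi (f *~ k) = pi f *+ odd `|k|%N.
  by rewrite raddfMz two_torsion_mulz.
have ord2 f : f + f = 0 -> pi f != 0 -> #[f]%g = 2%N.
  move=> ff nf; have : (#[f]%g %| 2)%N by rewrite order_dvdn FinRing.zmodXgE mulr2n ff.
  rewrite dvdn_divisors // inE => /orP [|]; last by rewrite inE => /eqP.
  by rewrite order_eq1 => /eqP f1'; case/negP: nf; rewrite f1' raddf0.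
split; [split|exact: ord2|exact: ord2|].
- move=> a; rewrite /= !big_ord_recl big_ord0 /= addr0 => e.
  have := congr1 pi e; rewrite !raddfD raddf0 /= !piz addrA => e'.
  have [o1 o2 o3] := indep_eq0 hi e'.
  have z1 : f1 *~ a ord0 = 0 by rewrite two_torsion_mulz // o1.
  have z2 : f2 *~ a (lift ord0 ord0) = 0 by rewrite two_torsion_mulz // o2.
  move: e; rewrite z1 z2 !add0r => z3.
  move=> i; have [/eqP ->//|] := boolP (i == ord0).
  have [/eqP ->//|] := boolP (i == lift ord0 ord0).
  have [/eqP ->//|] := boolP (i == lift ord0 (lift ord0 ord0)).
  by case: i => [[|[|[|]]]].
- apply/eqP; rewrite eqEsubset subsetT; apply/subsetP => g _.
  have [c1 [c2 [c3 ec]]] := indep_span (pi g) hi.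
  pose g' := f1 *+ c1 + f2 *+ c2 + f3 *+ c3.
  have gH : g - g' \in H.
    have eg : pi g' = pi g by rewrite ec /g' !raddfD !raddfMn.
    by rewrite piH raddfB eg subrr.
  have [k _ ek] := H_cyclic gH.
  have gen z : z \in [:: f1; f2; f3] -> z \in <<[set g0 in [:: f1; f2; f3]]>>%g.
    by move=> hz; apply: mem_gen; rewrite inE.
  have -> : g = f1 *+ c1 + f2 *+ c2 + f3 *+ c3 + f3 *+ (2 * k).
    by apply: (eq_from_sub ek); rewrite mulrnA mulr2n h3 /g'; zmod.
  rewrite -!FinRing.zmodXgE -!FinRing.zmodMgE !groupM // groupX // gen //.
  + by rewrite mem_head.
  + by rewrite !inE eqxx orbT.
  + by rewrite !inE eqxx !orbT.
  + by rewrite !inE eqxx !orbT.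
- apply/eqP; rewrite eqn_dvd order_dvdn FinRing.zmodXgE mulrnA mulr2n h3 xn eqxx /=.
  have e : f3 *+ #[f3]%g = 0 by rewrite -FinRing.zmodXgE expg_order.
  have o : odd #[f3]%g = false.
    apply/negP => o; have := congr1 pi e; rewrite raddf0 pmulrn piz /= o mulr1n.
    by move/eqP; rewrite (negbTE n3').
  have e2 := odd_double_half #[f3]%g; rewrite o add0n -mul2n in e2.
  by rewrite -e2 dvdn_pmul2l //; apply: mulrn_eq0_dvd; rewrite -h3 -mulr2n -mulrnA e2.
Qed.
End Basis.

Lemma perm_of_count_mem (T : eqType) (s t : seq T) :
  (forall x, count_mem x s = count_mem x t) -> perm_eq s t.
Proof. by move=> h; rewrite /perm_eq; apply/allP => x _ /=; rewrite h. Qed.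

Lemma perm_flatten_count (T : eqType) (L X : seq T) : uniq L -> {subset X <= L} ->
  perm_eq X (flatten [seq nseq (count_mem z X) z | z <- L]).
Proof.
move=> uL sX; apply: perm_of_count_mem => z.
rewrite count_flatten -map_comp sumnE big_map /=.
have nz L' : z \notin L' -> (\sum_(y <- L') count_mem z (nseq (count_mem y X) y) = 0)%N.
  move=> zL; apply: big1_seq => y /andP [_ yL]; rewrite count_nseq /=.
  by case: eqP => // e; rewrite -e yL in zL.
have [zL|zL] := boolP (z \in L); last first.
  by rewrite nz //; apply/count_memPn; apply: contra zL; apply: sX.
have [L' hL] := perm_cons_mem zL.
rewrite (perm_big _ hL) big_cons count_nseq /= eqxx mul1n nz ?addn0 //.
by move: uL; rewrite (perm_uniq hL) /= => /andP [].
Qed.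

Lemma nseq_odd (T : Type) k (u : T) : nseq (2 * k + 1) u = nseq k u ++ nseq k u ++ [:: u].
Proof. by rewrite -[[:: u]]/(nseq 1 u) -!nseqD mul2n -addnn addnA. Qed.

Section Normal.
Variables (G : finZmodType) (H : {set G}) (n : nat).
Hypotheses (H0 : 0 \in H) (HB : forall x y, x \in H -> y \in H -> x - y \in H).
Hypotheses (cardH : #|H| = n) (n1 : (1 < n)%N).
Variables (V : finZmodType) (pi : {additive G -> V}).
Hypotheses (cardV : #|V| = 8%N) (VV : forall v : V, v + v = 0).
Hypothesis (piH : forall x, (x \in H) = (pi x == 0)).
Variable S : seq G.
Hypotheses (fS : zsfree (2 * n) S) (sS : size S = (4 * n + 2)%N).

Definition expand (s : G) (m m' : G -> nat) (us : seq G) : seq G :=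
  flatten [seq nseq (2 * m u + 1) u ++ nseq (2 * m' u + 1) (s - u) | u <- us].

Lemma normal_form : exists a x s gs bs m m',
  [/\ [/\ a \in H, x \in H & forall d, (0 < d < n)%N -> x *+ d != 0],
    s + s = a + (a + x),
    size (gs ++ bs) = 3%N /\
      uniq [seq pi z | z <- (gs ++ bs) ++ [seq s - u | u <- gs ++ bs]],
    perm_eq S (expand s m m' (gs ++ bs)) /\
      (\sum_(u <- gs ++ bs) m u = n.-1 /\ \sum_(u <- gs ++ bs) m' u = n.-1)%N &
    {in gs, forall u, u + u = a} /\
    {in bs, forall u, [/\ m u = 0%N, m' u = 0%N, u + u <> a & u + u <> a + x]}].
Proof.
have [a [x [s [x1 [y1 [x2 [y2 [x3 [y3 [X [[aH xH ox] [e1 e2 e3 es] uL [XL pS] pX]]]]]]]]]]] :=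
  zsfree_structure H0 HB cardH n1 cardV VV piH fS sS.
have x0 : x != 0 by have := ox 1%N; rewrite mulr1n n1; apply.
pose b := a + x; have nab : (b == a) = false by rewrite -subr_eq0 addrAC subrr add0r (negbTE x0).
pose g (p q : G) := if p + p == b then q else p.
have gP p q : p + q = s -> g p q + g p q <> b /\
    ((g p q = p /\ s - g p q = q) \/ (g p q = q /\ s - g p q = p)).
  move=> e; rewrite /g; case: eqP => [pb|npb]; split=> //.
  - move=> qb; case/negP: x0; apply/eqP; rewrite /b in pb qb.
    zmod_by (eqD (eqN pb) (eqD (eqN qb) (eqD e (eqD e es)))).
  - by right; split=> //; zmod_by (eqN e).
  - by left; split=> //; zmod_by (eqN e).
pose us := [:: g x1 y1; g x2 y2; g x3 y3].
pose L := us ++ [seq s - u | u <- us].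
pose m u := count_mem u X; pose m' u := count_mem (s - u) X.
have pL : perm_eq L [:: x1; y1; x2; y2; x3; y3].
  rewrite /L /us /=; case: (gP _ _ e1) => _ [] [-> ->]; case: (gP _ _ e2) => _ [] [-> ->];
    by case: (gP _ _ e3) => _ [] [-> ->]; permlia.
have uL' : uniq [seq pi z | z <- L] by rewrite (perm_uniq (perm_map pi pL)).
have XL' : {subset X <= L} by move=> z /XL; rewrite (perm_mem pL).
have pX' := perm_flatten_count (map_uniq uL') XL'.
have dX z : z \in X -> z + z = a \/ z + z = b.
  move=> zX; have : z + z \in [seq z + z | z <- X] by apply/mapP; exists z.
  by rewrite (perm_mem pX) mem_cat !mem_nseq => /orP [] /andP [_ /eqP]; [left|right].
have nb u : u \in us -> u + u <> b.
  rewrite !inE => /or3P [] /eqP ->; [case: (gP _ _ e1)|case: (gP _ _ e2)|case: (gP _ _ e3)] => //.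
have bad u : u \in us -> u + u != a -> m u = 0%N /\ m' u = 0%N.
  move=> uu /eqP ua; have ub := nb u uu; split; apply/count_memPn/negP => /dX [] // h.
    by apply: ub; rewrite /b; zmod_by (eqD es (eqN h)).
  by apply: ua; rewrite /b in h; zmod_by (eqD es (eqN h)).
have cX c : count_mem c [seq z + z | z <- X] = count (fun z => z + z == c) X.
  by rewrite count_map.
have caX : count (fun z => z + z == a) X = n.-1.
  by rewrite -cX (seq.permP pX) count_cat !count_nseq /= eqxx -/b nab mul0n addn0 mul1n.
have cbX : count (fun z => z + z == b) X = n.-1.
  by rewrite -cX (seq.permP pX) count_cat !count_nseq /= eqxx -/b eq_sym nab mul0n add0n mul1n.
have ca u : u \in us -> ((u + u == a)%R * m u + ((s - u) + (s - u) == a)%R * m' u = m u)%N.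
  move=> uu; case: (altP (u + u =P a)) => [ua|/(bad u uu) [-> ->]]; last by rewrite !muln0.
  have -> : ((s - u) + (s - u) == a) = false.
    rewrite -nab; congr (_ == _); rewrite /b; zmod_by (eqD es (eqN ua)).
  by rewrite mul1n mul0n addn0.
have cb u : u \in us -> ((u + u == b)%R * m u + ((s - u) + (s - u) == b)%R * m' u = m' u)%N.
  move=> uu; have /eqP/negbTE -> := nb u uu; rewrite mul0n add0n.
  case: (altP (u + u =P a)) => [ua|/(bad u uu) [_ ->]]; last by rewrite !muln0.
  have -> : (s - u) + (s - u) = b by rewrite /b; zmod_by (eqD es (eqN ua)).
  by rewrite eqxx mul1n.
have us1 : g x1 y1 \in us by rewrite mem_head.
have us2 : g x2 y2 \in us by rewrite !inE eqxx orbT.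
have us3 : g x3 y3 \in us by rewrite !inE eqxx !orbT.
have sm : (\sum_(u <- us) m u = n.-1)%N.
  rewrite -caX (seq.permP pX') /L /us /= !count_cat !count_nseq /= !big_cons big_nil.
  rewrite -(ca _ us1) -(ca _ us2) -(ca _ us3) /m /m'; nlia.
have sm' : (\sum_(u <- us) m' u = n.-1)%N.
  rewrite -cbX (seq.permP pX') /L /us /= !count_cat !count_nseq /= !big_cons big_nil.
  rewrite -(cb _ us1) -(cb _ us2) -(cb _ us3) /m /m'; nlia.
have pSe : perm_eq S (expand s m m' us).
  have pX2 : perm_eq X (nseq (m (g x1 y1)) (g x1 y1) ++ nseq (m (g x2 y2)) (g x2 y2) ++
      nseq (m (g x3 y3)) (g x3 y3) ++ nseq (m' (g x1 y1)) (s - g x1 y1) ++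
      nseq (m' (g x2 y2)) (s - g x2 y2) ++ nseq (m' (g x3 y3)) (s - g x3 y3)).
    by move: pX'; rewrite /L /us /= cats0.
  rewrite /expand /= !nseq_odd; rewrite /L /us /= in pL.
  move: pX2 pL pS; clear.
  move: (g x1 y1) (g x2 y2) (g x3 y3) => u1 u2 u3 pX2 pL pS; permlia.
pose q u := u + u == a.
have pf : perm_eq us ([seq u <- us | q u] ++ [seq u <- us | ~~ q u]).
  by rewrite perm_sym; have /permPl := perm_filterC q us.
exists a, x, s, [seq u <- us | q u], [seq u <- us | ~~ q u], m, m'; split=> //.
- split; first by rewrite -(perm_size pf).
  rewrite -(perm_uniq (perm_map pi (perm_cat pf (perm_map (fun u => s - u) pf)))); exact: uL'.
- split; last by rewrite -!(perm_big _ pf).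
  apply: perm_trans pSe _; apply/perm_flatten/perm_map; exact: pf.
- split=> u; rewrite mem_filter => /andP [ua uu]; first exact/eqP.
  have [-> ->] := bad u uu ua; split=> //; [exact/eqP|exact: nb].
Qed.
End Normal.

Section Forms.
Variables (G : finZmodType) (H : {set G}) (n : nat).
Hypotheses (H0 : 0 \in H) (HB : forall x y, x \in H -> y \in H -> x - y \in H).
Hypotheses (cardH : #|H| = n) (n1 : (1 < n)%N).
Variables (V : finZmodType) (pi : {additive G -> V}).
Hypotheses (cardV : #|V| = 8%N) (VV : forall v : V, v + v = 0).
Hypothesis (piH : forall x, (x \in H) = (pi x == 0)).
Variable S : seq G.
Variables (a x s : G) (m m' : G -> nat).
Hypotheses (aH : a \in H) (xH : x \in H).
Hypothesis ordx : forall d, (0 < d < n)%N -> x *+ d != 0.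
Hypothesis es : s + s = a + (a + x).

Definition extremal_form : Prop :=
  exists f1 f2 f3 f : G,
    [/\ group_basis [:: f1; f2; f3],
        #[f1]%g = 2%N, #[f2]%g = 2%N, #[f3]%g = (2 * n)%N &
        [\/ exists a alpha beta : nat,
              [/\ (2 <= a <= n - 1)%N, (alpha <= n - 1)%N, (beta <= n - 1)%N &
                  perm_eq (translate (- f) S) (seq_s1 n f1 f2 f3 a alpha beta)],
            exists a b : nat,
              [/\ (2 <= a <= n - 1)%N, (2 <= b <= n - 1)%N, (b <= a)%N &
                  perm_eq (translate (- f) S) (seq_s2 n f1 f2 f3 a b)] |
            exists (alpha beta gamma : nat) (d : seq G),
              [/\ [/\ (alpha <= n - 1)%N, (beta <= n - 1)%N,
                      (gamma <= n - 1)%N & (alpha + beta + gamma = n - 1)%N],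
                  size d = (2 * n + 1)%N,
                  {subset d <= <<[set f1; f2]>>%g},
                  \sum_(x <- d) x \notin d &
                  perm_eq (translate (- f) S)
                          (seq_s3 f1 f2 f3 alpha beta gamma d)]]].

Lemma indep_of_uniq u1 u2 u3 :
  uniq [seq pi z | z <- [:: u1; u2; u3; s - u1; s - u2; s - u3]] ->
  indep (pi (u2 - u1)) (pi (u3 - u1)) (pi s).
Proof.
rewrite /= !inE !negb_or !raddfB /=.
case/and3P => /and5P [h12 h13 h11 h1s2 h1s3] /and4P [h23 h2s1 h2s2 h2s3] _.
have key (v p q : V) : p + q = v -> p != q -> v != 0.
  move=> <-; apply: contraNneq => e; rewrite -subr_eq0.
  by have -> : p - q = p + q; [zmod2 VV|rewrite e].
apply/indepP; split; [| | |split].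
- by apply: key h12; zmod2 VV.
- by apply: key h13; zmod2 VV.
- by apply: key h11; zmod2 VV.
- by apply: key h23; zmod2 VV.
- by apply: key h1s2; zmod2 VV.
- by apply: key h1s3; zmod2 VV.
- by apply: key h2s3; zmod2 VV.
Qed.

Lemma double_multiple u1 u : u1 + u1 = a -> u + u <> a -> u + u <> a + x ->
  exists2 k, (2 <= k <= n - 1)%N & (u - u1) + (u - u1) = x *+ k.
Proof.
move=> e1 na nb; have hH : (u - u1) + (u - u1) \in H by rewrite piH raddfD VV.
have [k kn ek] := H_cyclic H0 HB cardH n1 piH xH ordx hH.
exists k => //; case: k kn ek => [|[|k]] kn ek; last by nlia.
  by case: na; rewrite mulr0n in ek; zmod_by (eqD ek e1).
by case: nb; rewrite mulr1n in ek; zmod_by (eqD ek e1).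
Qed.

Let pia : pi a = 0. Proof. by apply/eqP; rewrite -piH. Qed.

Let basis := basis_of_indep H0 HB cardH n1 cardV VV piH xH ordx.

Lemma translate_expand u1 u2 u3 f : perm_eq S (expand s m m' [:: u1; u2; u3]) ->
  perm_eq (translate (- f) S)
    (nseq (2 * m u1 + 1) (- f + u1) ++ nseq (2 * m' u1 + 1) (- f + (s - u1)) ++
     nseq (2 * m u2 + 1) (- f + u2) ++ nseq (2 * m' u2 + 1) (- f + (s - u2)) ++
     nseq (2 * m u3 + 1) (- f + u3) ++ nseq (2 * m' u3 + 1) (- f + (s - u3))).
Proof.
move/(perm_map (fun g => - f + g)); rewrite /expand /= cats0 !map_cat !map_nseq.
by rewrite -!catA.
Qed.

Lemma form_three u1 u2 u3 : u1 + u1 = a -> u2 + u2 = a -> u3 + u3 = a ->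
  uniq [seq pi z | z <- [:: u1; u2; u3; s - u1; s - u2; s - u3]] ->
  perm_eq S (expand s m m' [:: u1; u2; u3]) ->
  (m u1 + m u2 + m u3 = n - 1)%N -> (m' u1 + m' u2 + m' u3 = n - 1)%N ->
  extremal_form.
Proof.
move=> e1 e2 e3 /indep_of_uniq hi /(translate_expand u1) pS sm sm'.
pose f1 := u2 - u1; pose f2 := u3 - u1; pose f3 := s - a.
have h1 : f1 + f1 = 0 by rewrite /f1; zmod_by (eqD e2 (eqN e1)).
have h2 : f2 + f2 = 0 by rewrite /f2; zmod_by (eqD e3 (eqN e1)).
have h3 : f3 + f3 = x by rewrite /f3; zmod_by es.
have hi' : indep (pi f1) (pi f2) (pi f3) by rewrite [pi f3]raddfB pia subr0.
have [hb o1 o2 o3] := basis h1 h2 h3 hi'.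
have /indepP [n1' n2' _ [n12 _ _ _]] := hi'.
exists f1, f2, f3, u1; split=> //; apply: Or33.
exists (m u1), (m u2), (m u3), (nseq (2 * m' u1 + 1) 0 ++
  nseq (2 * m' u2 + 1) f1 ++ nseq (2 * m' u3 + 1) f2).
split.
- split; nlia.
- rewrite !size_cat !size_nseq; nlia.
- have sub z : z \in [:: f1; f2] -> z \in <<[set f1; f2]>>%g.
    by move=> hz; apply: mem_gen; rewrite !inE in hz *.
  move=> z; rewrite !mem_cat !mem_nseq => /or3P [] /andP [_ /eqP ->].
  + exact: group1.
  + by apply: sub; rewrite mem_head.
  + by apply: sub; rewrite !inE eqxx orbT.
- have odd_mul (f : G) k : f + f = 0 -> f *+ (2 * k + 1) = f.
    by move=> ff; rewrite mulrnDr mulrnA mulr2n ff mul0rn add0r.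
  rewrite !big_cat /= !sum_nseq !odd_mul ?addr0 // add0r.
  rewrite !mem_cat !mem_nseq !addn1 /= !negb_or; apply/and3P; split.
  + by apply: contraNneq n12 => e; rewrite -raddfD e raddf0.
  + by apply: contraNneq n2' => e; rewrite -(addrK f1 f2) [f2 + f1]addrC e subrr raddf0.
  + by apply: contraNneq n1' => e; rewrite -(addrK f2 f1) e subrr raddf0.
- have e4 : - u1 + (s - u1) = f3 + 0 by rewrite /f3; zmod_by (eqN e1).
  have e5 : - u1 + (s - u2) = f3 + f1 by rewrite /f3 /f1; zmod_by (eqN e2).
  have e6 : - u1 + (s - u3) = f3 + f2 by rewrite /f3 /f2; zmod_by (eqN e3).
  have e7 : - u1 + u2 = f1 by rewrite /f1; zmod.
  have e8 : - u1 + u3 = f2 by rewrite /f2; zmod.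
  rewrite addNr e4 e5 e6 e7 e8 in pS.
  rewrite /seq_s3 !map_cat !map_nseq; permlia.
Qed.

Lemma form_two u1 u2 u3 : u1 + u1 = a -> u2 + u2 = a -> u3 + u3 <> a -> u3 + u3 <> a + x ->
  m u3 = 0%N -> m' u3 = 0%N ->
  uniq [seq pi z | z <- [:: u1; u2; u3; s - u1; s - u2; s - u3]] ->
  perm_eq S (expand s m m' [:: u1; u2; u3]) ->
  (m u1 + m u2 = n - 1)%N -> (m' u1 + m' u2 = n - 1)%N -> extremal_form.
Proof.
move=> e1 e2 na nb m0 m0' /indep_of_uniq hi /(translate_expand u1) pS sm sm'.
have [A hA eA] := double_multiple e1 na nb.
pose f2 := u2 - u1; pose f3 := s - a + f2; pose f1 := u3 - u1 - f3 *+ A.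
have h2 : f2 + f2 = 0 by rewrite /f2; zmod_by (eqD e2 (eqN e1)).
have h3 : f3 + f3 = x by rewrite /f3; zmod_by (eqD es h2).
have e3A : f3 *+ A + f3 *+ A = x *+ A by rewrite -mulrnDl h3.
have h1 : f1 + f1 = 0 by rewrite /f1; zmod_by (eqD eA (eqN e3A)).
have p3 : pi f3 = pi s + pi f2 by rewrite raddfD [pi (s - a)]raddfB pia subr0.
have p1 : pi f1 = pi (u3 - u1) + pi f3 *+ A.
  by rewrite [pi f1]raddfB raddfMn /=; zmod2 VV.
have hi' : indep (pi f1) (pi f2) (pi f3).
  rewrite p1 p3; apply/indep_swap/indep_rot/(indep_addMn VV).
  exact/indep_rot/indep_rot/(indep_add VV).
have [hb o1 o2 o3] := basis h1 h2 h3 hi'.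
exists f1, f2, f3, u1; split=> //; apply: Or31.
exists A, (m u1), (m' u1); split=> //; [nlia|nlia|].
have e4 : - u1 + (s - u1) = f3 + f2 by rewrite /f3; zmod_by (eqN (eqD e1 h2)).
have e5 : - u1 + (s - u2) = f3 by rewrite /f3 /f2; zmod_by (eqN e2).
have e6 : - u1 + u3 = f3 *~ A%:Z + f1 by rewrite /f1 -pmulrn; zmod.
have e7 : - u1 + (s - u3) = f3 *~ (1 - A%:Z) + f2 + f1.
  rewrite mulrzBr mulr1z -pmulrn /f1 {1}/f3.
  zmod_by (eqD (eqN e1) (eqD (eqN h2) (eqD e3A (eqN eA)))).
have e8 : - u1 + u2 = f2 by rewrite /f2; zmod.
rewrite addNr m0 m0' e4 e5 e6 e7 e8 in pS.
have c1 : (2 * n - 2 * m u1 - 1 = 2 * m u2 + 1)%N by nlia.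
have c2 : (2 * n - 1 - 2 * m' u1 = 2 * m' u2 + 1)%N by nlia.
rewrite /seq_s1 c1 c2; permlia.
Qed.

Lemma form_one u1 u2 u3 A B : u1 + u1 = a ->
  (u2 - u1) + (u2 - u1) = x *+ A -> (u3 - u1) + (u3 - u1) = x *+ B ->
  (2 <= A <= n - 1)%N -> (2 <= B <= n - 1)%N -> (B <= A)%N ->
  m u2 = 0%N -> m' u2 = 0%N -> m u3 = 0%N -> m' u3 = 0%N ->
  uniq [seq pi z | z <- [:: u1; u2; u3; s - u1; s - u2; s - u3]] ->
  perm_eq S (expand s m m' [:: u1; u2; u3]) ->
  (m u1 = n - 1)%N -> (m' u1 = n - 1)%N -> extremal_form.
Proof.
move=> e1 eA eB hA hB hAB m2 m2' m3 m3' /indep_of_uniq hi /(translate_expand u1) pS sm sm'.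
pose f3 := s - a; pose f2 := u2 - u1 - f3 *+ A; pose f1 := u3 - u1 - f3 *+ B.
have h3 : f3 + f3 = x by rewrite /f3; zmod_by es.
have e3A : f3 *+ A + f3 *+ A = x *+ A by rewrite -mulrnDl h3.
have e3B : f3 *+ B + f3 *+ B = x *+ B by rewrite -mulrnDl h3.
have h2 : f2 + f2 = 0 by rewrite /f2; zmod_by (eqD eA (eqN e3A)).
have h1 : f1 + f1 = 0 by rewrite /f1; zmod_by (eqD eB (eqN e3B)).
have p3 : pi f3 = pi s by rewrite raddfB pia subr0.
have p1 : pi f1 = pi (u3 - u1) + pi f3 *+ B.
  by rewrite [pi f1]raddfB raddfMn /=; zmod2 VV.
have p2 : pi f2 = pi (u2 - u1) + pi f3 *+ A.
  by rewrite [pi f2]raddfB raddfMn /=; zmod2 VV.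
have hi' : indep (pi f1) (pi f2) (pi f3).
  rewrite p1 p2 p3; apply/indep_rot/(indep_addMn VV)/indep_rot/indep_rot/indep_swap.
  exact/indep_rot/(indep_addMn VV)/indep_rot/indep_rot.
have [hb o1 o2 o3] := basis h1 h2 h3 hi'.
exists f1, f2, f3, u1; split=> //; apply: Or32.
exists A, B; split=> //.
have e4 : - u1 + (s - u1) = f3 by rewrite /f3; zmod_by (eqN e1).
have e6 : - u1 + u3 = f3 *~ B%:Z + f1 by rewrite /f1 -pmulrn; zmod.
have e5 : - u1 + u2 = f3 *~ A%:Z + f2 by rewrite /f2 -pmulrn; zmod.
have e7 : - u1 + (s - u3) = f3 *~ (1 - B%:Z) + f1.
  rewrite mulrzBr mulr1z -pmulrn /f1 {1}/f3.
  zmod_by (eqD (eqN e1) (eqD e3B (eqN eB))).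
have e8 : - u1 + (s - u2) = f3 *~ (1 - A%:Z) + f2.
  rewrite mulrzBr mulr1z -pmulrn /f2 {1}/f3.
  zmod_by (eqD (eqN e1) (eqD e3A (eqN eA))).
rewrite addNr m2 m2' m3 m3' sm sm' e4 e5 e6 e7 e8 in pS.
have c1 : (2 * (n - 1) + 1 = 2 * n - 1)%N by nlia.
rewrite c1 in pS; rewrite /seq_s2; permlia.
Qed.

End Forms.

Theorem zsfree_extremal_form (G : finZmodType) (H : {set G}) (n : nat)
    (V : finZmodType) (pi : {additive G -> V}) (S : seq G) :
  0 \in H -> (forall x y, x \in H -> y \in H -> x - y \in H) -> #|H| = n -> (1 < n)%N ->
  #|V| = 8%N -> (forall v : V, v + v = 0) -> (forall x, (x \in H) = (pi x == 0)) ->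
  size S = (4 * n + 2)%N -> zsfree (2 * n) S -> extremal_form n S.
Proof.
move=> H0 HB cardH n1 cardV VV piH sS fS.
have [a [x [s [gs [bs [m [m' [[aH xH ox] es [sz uq] [pS [sm sm']] [hg hb]]]]]]]]] :=
  normal_form H0 HB cardH n1 cardV VV piH fS sS.
case: gs sz uq pS sm sm' hg => [|u1 [|u2 [|u3 [|u4 gs]]]] //=.
- move=> _ _ _; rewrite big1_seq; first by nlia.
  by move=> u /andP [_ /hb []].
- case: bs hb => [|u2 [|u3 [|u4 bs]]] // hb _ uq pS sm sm' hg.
  have [m2 m2' na2 nb2] := hb u2 (mem_head _ _).
  have [m3 m3' na3 nb3] : [/\ m u3 = 0%N, m' u3 = 0%N, u3 + u3 <> a & u3 + u3 <> a + x].
    by apply: hb; rewrite !inE eqxx orbT.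
  have e1 := hg u1 (mem_head _ _).
  have [A hA eA] := double_multiple H0 HB cardH n1 cardV VV piH xH ox e1 na2 nb2.
  have [B hB eB] := double_multiple H0 HB cardH n1 cardV VV piH xH ox e1 na3 nb3.
  rewrite !big_cons big_nil m2 m3 in sm; rewrite !big_cons big_nil m2' m3' in sm'.
  have [hAB|hAB] := leqP B A.
    by apply: (form_one H0 HB cardH n1 cardV VV piH aH xH ox es e1 eA eB hA hB hAB
      m2 m2' m3 m3' uq pS); nlia.
  have uq' : uniq [seq pi z | z <- [:: u1; u3; u2; s - u1; s - u3; s - u2]].
    rewrite -(perm_uniq (s1 := [seq pi z | z <- [:: u1; u2; u3; s - u1; s - u2; s - u3]])) //.
    by apply: perm_map; permlia.
  have pS' : perm_eq S (expand s m m' [:: u1; u3; u2]).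
    by move: pS; rewrite /expand /= => pS; permlia.
  apply: (form_one H0 HB cardH n1 cardV VV piH aH xH ox es e1 eB eA hB hA _
    m3 m3' m2 m2' uq' pS'); nlia.
- case: bs hb => [|u3 [|u4 bs]] // hb _ uq pS sm sm' hg.
  have [m3 m3' na3 nb3] := hb u3 (mem_head _ _).
  have e1 := hg u1 (mem_head _ _).
  have e2 : u2 + u2 = a by apply: hg; rewrite !inE eqxx orbT.
  rewrite !big_cons big_nil m3 in sm; rewrite !big_cons big_nil m3' in sm'.
  apply: (form_two H0 HB cardH n1 cardV VV piH aH xH ox es e1 e2 na3 nb3 m3 m3' uq pS); nlia.
- case: bs hb => // hb _ uq pS sm sm' hg.
  have e1 := hg u1 (mem_head _ _).
  have e2 : u2 + u2 = a by apply: hg; rewrite !inE eqxx orbT.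
  have e3 : u3 + u3 = a by apply: hg; rewrite !inE eqxx !orbT.
  rewrite !big_cons big_nil in sm; rewrite !big_cons big_nil in sm'.
  apply: (form_three H0 HB cardH n1 cardV VV piH aH xH ox es e1 e2 e3 uq pS); nlia.
Qed.

Lemma perm_nseq_split (T : eqType) k (x : T) (B t u : seq T) :
  perm_eq (nseq k x ++ B) (t ++ u) ->
  exists j t' u', [/\ (j <= k)%N, perm_eq t (nseq j x ++ t') & perm_eq B (t' ++ u')].
Proof.
elim: k t u => [|k IH] t u /= h; first by exists 0%N, t, u.
have : x \in t ++ u by rewrite -(perm_mem h) mem_head.
rewrite mem_cat => /orP [] /perm_cons_mem [s hs].
  have [|j [t' [u' [jk h1 h2]]]] := IH s u; first by rewrite -(perm_cons x); permlia.
  by exists j.+1, t', u'; split=> //=; permlia.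
have [|j [t' [u' [jk h1 h2]]]] := IH t s; first by rewrite -(perm_cons x); permlia.
by exists j, t', u'; split=> //; apply: leqW.
Qed.

Lemma perm_seq2_split (T : eqType) (p q : T) (B t u : seq T) :
  perm_eq ([:: p, q & B]) (t ++ u) ->
  exists j k t' u', [/\ (j <= 1)%N, (k <= 1)%N, perm_eq t (nseq j p ++ nseq k q ++ t') &
    perm_eq B (t' ++ u')].
Proof.
move=> h; have [j [t1 [u1 [j1 h1 h2]]]] := @perm_nseq_split _ 1 p (q :: B) t u h.
have [k [t2 [u2 [k1 h3 h4]]]] := @perm_nseq_split _ 1 q B t1 u1 h2.
by exists j, k, t2, u2; split=> //; permlia.
Qed.

(** * The extremal sequences *)

Section Converse.
Variables (G : finZmodType) (n : nat) (f1 f2 f3 : G).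
Hypothesis n1 : (1 < n)%N.
Hypotheses (hb : independent [:: f1; f2; f3]) (o1 : #[f1]%g = 2%N) (o2 : #[f2]%g = 2%N)
  (o3 : #[f3]%g = (2 * n)%N).

Lemma independent3 (k1 k2 k3 : int) : f1 *~ k1 + f2 *~ k2 + f3 *~ k3 = 0 ->
  [/\ f1 *~ k1 = 0, f2 *~ k2 = 0 & f3 *~ k3 = 0].
Proof.
move=> e; have /= := hb (a := fun i => nth 0 [:: k1; k2; k3] i).
rewrite !big_ord_recl big_ord0 /= addr0 addrA => /(_ e) h.
by split; [have := h ord0|have := h (lift ord0 ord0)|have := h (lift ord0 (lift ord0 ord0))].
Qed.

Lemma combination0 j1 j2 j3 : f1 *+ j1 + f2 *+ j2 + f3 *+ j3 = 0 ->
  [/\ ~~ odd j1, ~~ odd j2 & (2 * n %| j3)%N].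
Proof.
move=> e; have [] := @independent3 j1 j2 j3; first by rewrite -!pmulrn.
rewrite -!pmulrn -!FinRing.zmodXgE => /eqP z1 /eqP z2 /eqP z3.
by move: z1 z2 z3; rewrite -![_ == 0]/(_ == 1%g) -!order_dvdn o1 o2 o3 !dvdn2.
Qed.

Lemma f3n : f3 *+ (2 * n) = 0.
Proof. by rewrite -FinRing.zmodXgE -o3 expg_order. Qed.

Lemma dvdn_small d k : (d %| k)%N -> (k < 2 * d)%N -> k = 0%N \/ k = d.
Proof.
case/dvdnP => [[|[|q]] ->]; [by left|by right; rewrite mul1n|].
by rewrite -addn2 mulnDl addnC ltnNge leq_addr.
Qed.

Lemma zsfree_s1 a alpha beta : (alpha <= n - 1)%N -> (beta <= n - 1)%N ->
  zsfree (2 * n) (seq_s1 n f1 f2 f3 a alpha beta).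
Proof.
move=> ha hbt T U; rewrite /seq_s1.
move=> /perm_nseq_split [j0 [T1 [U1 [b0 p0]]]].
move=> /perm_nseq_split [j2 [T2 [U2 [b2 p2]]]].
move=> /perm_nseq_split [j3 [T3 [U3 [b3 p3]]]].
move=> /perm_nseq_split [j4 [T4 [U4 [b4 p4]]]].
move=> /perm_seq2_split [e1 [e2 [T5 [U5 [c1 c2 p5]]]]].
move=> /perm_size/esym/eqP; rewrite size_cat addn_eq0 => /andP [/nilP z5 _].
rewrite {}z5 in p5.
have pT : perm_eq T (nseq j0 0 ++ nseq j2 f2 ++ nseq j3 f3 ++ nseq j4 (f3 + f2) ++
  nseq e1 (f3 *~ a%:Z + f1) ++ nseq e2 (f3 *~ (1 - a%:Z) + f2 + f1)) by permlia.
have := perm_size pT; rewrite !size_cat !size_nseq => sT hT.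
rewrite hT in sT; rewrite (perm_big _ pT) !big_cat /= !sum_nseq mul0rn add0r => e.
rewrite mulrzBr mulr1z mulrnDl in e.
have aux : (f1 *+ e1 + f1 *+ e2 + (f2 *+ (j2 + j4) + f2 *+ e2) +
    (f3 *+ (j3 + j4) + f3 *+ e2 + f3 *~ a *+ e1 - f3 *~ a *+ e2)) = 0.
  rewrite !mulrnDr; rewrite !mulrnDl mulNrn in e; zmod_by e.
case: e1 e2 c1 c2 aux sT {e p5 pT} => [|[|e1]] [|[|e2]] // _ _ e sT.
- have [|_ h2 /dvdn_small h3] := @combination0 0 (j2 + j4) (j3 + j4); first by zmod_by e.
  have := even_halfK h2; rewrite -mul2n; move: (_./2) => q hq.
  by case: h3 => [|h3|h3]; nlia.
- have [|] := @independent3 1 (j2 + j4 + 1)%N ((j3 + j4 + 1)%N%:Z - a%:Z).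
    rewrite mulrzBr mulr1z -!pmulrn 2!(mulrnDr _ _ 1); zmod_by e.
  by rewrite mulr1z => f10; move: o1; rewrite f10 order1.
- have [|] := @combination0 1 (j2 + j4) (j3 + j4 + a); last by [].
  rewrite (mulrnDr _ (j3 + j4) a); zmod_by e.
- have [|_ h2 /dvdn_small h3] := @combination0 2 (j2 + j4 + 1) (j3 + j4 + 1).
    rewrite 2!(mulrnDr _ _ 1); zmod_by e.
  have := even_halfK h2; rewrite -mul2n; move: (_./2) => q hq.
  by case: h3 => [|h3|h3]; nlia.
Qed.

Lemma zsfree_s2 a b : zsfree (2 * n) (seq_s2 n f1 f2 f3 a b).
Proof.
move=> T U; rewrite /seq_s2.
move=> /perm_nseq_split [j0 [T1 [U1 [b0 p0]]]].
move=> /perm_nseq_split [j3 [T3 [U3 [b3 p3]]]].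
move=> /perm_seq2_split [e1 [e2 [T5 [U5 [c1 c2 p5]]]]].
move=> /perm_seq2_split [e3 [e4 [T6 [U6 [c3 c4 p6]]]]].
move=> /perm_size/esym/eqP; rewrite size_cat addn_eq0 => /andP [/nilP z6 _].
rewrite {}z6 in p6.
have pT : perm_eq T (nseq j0 0 ++ nseq j3 f3 ++
  nseq e1 (f3 *~ a%:Z + f2) ++ nseq e2 (f3 *~ (1 - a%:Z) + f2) ++
  nseq e3 (f3 *~ b%:Z + f1) ++ nseq e4 (f3 *~ (1 - b%:Z) + f1)) by permlia.
have := perm_size pT; rewrite !size_cat !size_nseq => sT hT.
rewrite hT in sT; rewrite (perm_big _ pT) !big_cat /= !sum_nseq mul0rn add0r => e.
pose K : int := j3%:Z + a%:Z * e1%:Z + (1 - a%:Z) * e2%:Z + b%:Z * e3%:Z + (1 - b%:Z) * e4%:Z.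
have eK : f3 *~ K = f3 *+ j3 + f3 *~ a%:Z *+ e1 + f3 *~ (1 - a%:Z) *+ e2 +
    f3 *~ b%:Z *+ e3 + f3 *~ (1 - b%:Z) *+ e4.
  by rewrite /K; move: (1 - a%:Z) (1 - b%:Z) => a' b'; rewrite !mulrzDr !mulrzA -!pmulrn.
have [|z1 z2 _] := @independent3 (e3 + e4)%N (e1 + e2)%N K.
  rewrite eK -!pmulrn !mulrnDr; rewrite !mulrnDl in e; zmod_by e.
have par (f : G) (i j : nat) : #[f]%g = 2%N -> (i <= 1)%N -> (j <= 1)%N ->
    f *~ (i + j)%N%:Z = 0 -> i = j.
  move=> o hi hj; rewrite -pmulrn -FinRing.zmodXgE => /eqP.
  rewrite -[_ == 0]/(_ == 1%g) -order_dvdn o.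
  by case: i j hi hj => [|[|i]] [|[|j]].
have e12 := par _ _ _ o2 c1 c2 z2; have e34 := par _ _ _ o1 c3 c4 z1.
rewrite -{}e12 -{}e34 in e sT.
have [|_ _ /dvdn_small h3] := @combination0 (e3 + e3) (e1 + e1) (j3 + e1 + e3).
  rewrite !mulrnDr; rewrite !mulrnDl !mulrzBr mulr1z !mulrnDl !mulNrn in e; zmod_by e.
by case: h3 => [|h3|h3]; nlia.
Qed.

Lemma generated_combination z : z \in <<[set f1; f2]>>%g ->
  exists i j, z = f1 *+ i + f2 *+ j.
Proof.
have -> : <<[set f1; f2]>>%g = (<[f1]> * <[f2]>)%g.
  rewrite -cent_joinEr; first by rewrite /cycle joing_idl joing_idr.
  by apply/centsP => u _ v _; rewrite /commute !FinRing.zmodMgE addrC.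
by case/mulsgP => u v /cycleP [i ->] /cycleP [j ->] ->; exists i, j.
Qed.

Lemma sum_generated_combination (d : seq G) : {subset d <= <<[set f1; f2]>>%g} ->
  exists i j, \sum_(x <- d) x = f1 *+ i + f2 *+ j.
Proof.
elim: d => [|z d IH] hd; first by exists 0%N, 0%N; rewrite big_nil !mulr0n addr0.
have [i [j ez]] := generated_combination (hd z (mem_head _ _)).
have [|i' [j' ed]] := IH; first by move=> y hy; apply: hd; rewrite inE hy orbT.
by exists (i + i')%N, (j + j')%N; rewrite big_cons ez ed !mulrnDr; zmod.
Qed.

Lemma zsfree_s3 alpha beta gamma (d : seq G) : (alpha + beta + gamma = n - 1)%N ->
  size d = (2 * n + 1)%N -> {subset d <= <<[set f1; f2]>>%g} -> \sum_(x <- d) x \notin d ->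
  zsfree (2 * n) (seq_s3 f1 f2 f3 alpha beta gamma d).
Proof.
move=> habc sd hd nd T U; rewrite /seq_s3.
move=> /perm_nseq_split [j0 [T1 [U1 [b0 p0]]]].
move=> /perm_nseq_split [j1 [T2 [U2 [b1 p1]]]].
move=> /perm_nseq_split [j2 [T3 [U3 [b2 p2]]]].
move=> /perm_map_split [d1 [d2 [pd ed _]]].
have pT : perm_eq T (nseq j0 0 ++ nseq j1 f1 ++ nseq j2 f2 ++ [seq f3 + x | x <- d1]).
  by rewrite ed; permlia.
have hd1 : {subset d1 <= <<[set f1; f2]>>%g}.
  by move=> z hz; apply: hd; rewrite (perm_mem pd) mem_cat hz.
have [i [j es]] := sum_generated_combination hd1.
have := perm_size pT; rewrite !size_cat !size_nseq size_map => sT hT.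
rewrite hT in sT; rewrite (perm_big _ pT) !big_cat /= !sum_nseq mul0rn add0r sum_map_add es => e.
have [|h1 h2 /dvdn_small h3] := @combination0 (j1 + i) (j2 + j) (size d1).
  by rewrite !mulrnDr; zmod_by e.
have sd2 := perm_size pd; rewrite size_cat sd in sd2.
case: h3 => [|h3|h3]; first by nlia.
  have d0 : d1 = [::] by apply: size0nil.
  have [|h1' h2' _] := @combination0 j1 j2 0.
    by rewrite -es d0 big_nil /= in e; zmod_by e.
  have := even_halfK h1'; have := even_halfK h2'; rewrite -!mul2n.
  move: (j1./2) (j2./2) => q1 q2 hq1 hq2; nlia.
case: d2 pd sd2 => [|z [|z' d2]] pd sd2; [by move: sd2 => /=; nlia| |by move: sd2 => /=; nlia].
have [z1 [z2 z3]] : j0 = 0%N /\ j1 = 0%N /\ j2 = 0%N by nlia.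
case/negP: nd; rewrite (perm_big _ pd) big_cat big_seq1 /= es.
suff -> : f1 *+ i + f2 *+ j = 0 by rewrite add0r (perm_mem pd) mem_cat mem_head orbT.
by rewrite z2 z3 h3 f3n in e; zmod_by e.
Qed.
End Converse.

Section Parity.
Variable n : nat.
Hypothesis n1 : (1 < n)%N.

Definition Zp_mod2 (u : 'Z_(2 * n)) : 'Z_2 := (u : nat)%:R.

Lemma Zp_mod2_natr (k : nat) : Zp_mod2 k%:R = k%:R.
Proof.
rewrite /Zp_mod2 val_Zp_nat; last by nlia.
by rewrite -[LHS]Zp_nat_mod // modn_dvdm ?dvdn_mulr // Zp_nat_mod.
Qed.

Lemma Zp_mod2D : {morph Zp_mod2 : u v / u + v}.
Proof.
by move=> u v; rewrite -{1}(natr_Zp u) -{1}(natr_Zp v) -natrD Zp_mod2_natr natrD.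
Qed.

Variables (G : finZmodType) (phi : {additive G -> ('Z_2 * 'Z_2 * 'Z_(2 * n))%type}).

Definition parity (g : G) : 'rV['Z_2]_3 :=
  \row_i nth 0 [:: (phi g).1.1; (phi g).1.2; Zp_mod2 (phi g).2] i.

Lemma parity_is_zmod_morphism : zmod_morphism parity.
Proof.
move=> g h; apply/rowP => i; rewrite !mxE raddfB.
case: i => [[|[|[|]]]] //= _.
by apply: (addIr (Zp_mod2 (phi h).2)); rewrite -Zp_mod2D !subrK.
Qed.

Lemma exists_parity : bijective phi ->
  exists pi : {additive G -> 'rV['Z_2]_3}, #|[set x | pi x == 0]| = n.
Proof.
move=> bij_phi.
pose pi : {additive G -> 'rV['Z_2]_3} :=
  HB.pack parity (GRing.isZmodMorphism.Build _ _ parity parity_is_zmod_morphism).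
exists pi; set H := [set x | _].
have cG : #|G| = (8 * n)%N.
  rewrite (bij_eq_card bij_phi) !card_prod !card_ord !Zp_cast //; nlia.
have surj v : exists g, pi g = v.
  have [psi _ psiK] := bij_phi.
  exists (psi (v 0 ord0, v 0 (lift ord0 ord0), (v 0 ord_max : nat)%:R)).
  apply/rowP => i; rewrite mxE psiK /= Zp_mod2_natr natr_Zp.
  by case: i => [[|[|[|]]]] //= hi; congr (v 0 _); apply: val_inj.
have cfib v : #|[set x | pi x == v]| = #|H|.
  have [g gv] := surj v; rewrite -(card_imset H (addrI g)); apply: eq_card => y.
  rewrite inE; apply/eqP/imsetP => [yv|[h]].
    by exists (y - g); rewrite ?inE ?raddfB ?yv ?gv ?subrr //=; zmod.
  by rewrite inE => /eqP h0 ->; rewrite raddfD h0 gv addr0.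
have cGH : #|G| = (\sum_(v : 'rV['Z_2]_3) #|H|)%N.
  rewrite -[LHS]sum1_card (partition_big pi predT) //.
  by apply: eq_bigr => v _; rewrite -(cfib v) sum1dep_card.
move: cGH; rewrite cG sum_nat_const card_mx card_ord => /eqP.
by rewrite eqn_mul2l /= => /eqP.
Qed.

End Parity.

Theorem theorem5p1 (n : nat) (hn : (2 <= n)%N) (G : finZmodType)
  (isoG : exists phi : {additive G -> ('Z_2 * 'Z_2 * 'Z_(2 * n))%type},
            bijective phi)
  (S : seq G) (sizeS : size S = (4 * n + 2)%N) :
  ~ has_zero_sum_subseq (2 * n) S
  <->
  exists f1 f2 f3 f : G,
    [/\ group_basis [:: f1; f2; f3],
        #[f1]%g = 2%N, #[f2]%g = 2%N, #[f3]%g = (2 * n)%N &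
        [\/ exists a alpha beta : nat,
              [/\ (2 <= a <= n - 1)%N, (alpha <= n - 1)%N, (beta <= n - 1)%N &
                  perm_eq (translate (- f) S) (seq_s1 n f1 f2 f3 a alpha beta)],
            exists a b : nat,
              [/\ (2 <= a <= n - 1)%N, (2 <= b <= n - 1)%N, (b <= a)%N &
                  perm_eq (translate (- f) S) (seq_s2 n f1 f2 f3 a b)] |
            exists (alpha beta gamma : nat) (d : seq G),
              [/\ [/\ (alpha <= n - 1)%N, (beta <= n - 1)%N,
                      (gamma <= n - 1)%N & (alpha + beta + gamma = n - 1)%N],
                  size d = (2 * n + 1)%N,
                  {subset d <= <<[set f1; f2]>>%g},
                  \sum_(x <- d) x \notin d &
                  perm_eq (translate (- f) S)
                          (seq_s3 f1 f2 f3 alpha beta gamma d)]]].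
Proof.
have [phi bij_phi] := isoG; have [pi cardH] := exists_parity hn bij_phi.
have VV (v : 'rV['Z_2]_3) : v + v = 0.
  by apply/rowP => i; rewrite !mxE -mulr2n -mulr_natr (@pchar_Zp 2) ?mulr0.
set H := [set x | pi x == 0] in cardH.
have piH x : (x \in H) = (pi x == 0) by rewrite inE.
have H0 : 0 \in H by rewrite piH raddf0.
have HB x y : x \in H -> y \in H -> x - y \in H.
  by rewrite !piH raddfB => /eqP -> /eqP ->; rewrite subr0.
have exp2n (g : G) : g *+ (2 * n) = 0.
  by rewrite mulrnA mulr2n (mulrn_card H0 HB cardH) // piH raddfD /= VV.
rewrite zsfreeP; split.
  apply: (zsfree_extremal_form H0 HB cardH hn _ VV piH sizeS).
  by rewrite card_mx card_ord.
case=> f1 [f2 [f3 [f [[hb _] o1 o2 o3 hS]]]].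
suff : zsfree (2 * n) (translate (- f) S).
  by move=> /(zsfree_translate (exp2n f)); have := map_addK (- f) S; rewrite opprK /translate => ->.
case: hS => [[a [alpha [beta [_ ha hbt p]]]]|[a [b [_ _ _ p]]]|].
- rewrite perm_sym in p; exact: zsfree_perm p (zsfree_s1 hn hb o1 o2 o3 ha hbt).
- rewrite perm_sym in p; exact: zsfree_perm p (@zsfree_s2 G n f1 f2 f3 hn hb o1 o2 o3 a b).
case=> alpha [beta [gamma [d [[_ _ _ habc] sd hd nd p]]]].
rewrite perm_sym in p; exact: zsfree_perm p (zsfree_s3 hn hb o1 o2 o3 habc sd hd nd).
Qed.
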